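(* Let $n\ge 1$. The map $E\mapsto \Phi(E)=(\Phi_E(E_1),\dots,\Phi_E(E_n))$, where the tuple $\Phi(E)$ is regarded as the function $i\mapsto \Phi_E(E_i)$ on $\{1,\dots,n\}$, is a bijection from the set of complete exceptional sequences of $\Lambda_n$-modules onto the set of idempotent functions $\{1,\dots,n\}\to\{1,\dots,n\}$.
   Context: Let $k$ be an algebraically closed field and let $\Lambda_n=kQ/\mathrm{rad}^2(kQ)$ where $Q$ is the linearly oriented quiver $1\to 2\to\cdots\to n$ (the linear radical square zero Nakayama algebra of rank $n$); finite-dimensional $\Lambda_n$-modules are identified with finite-dimensional representations of $Q$ in which the composition of any two consecutive arrows is zero. The simple module at vertex $i$ is denoted $S_i$ or $[i]$; $[i,i+1]$ ($1\le i\le n-1$) is the nonsimple indecomposable projective module starting at $i$ (top $S_i$, socle $S_{i+1}$). These are all the indecomposable modules up to isomorphism. A module $M$ is exceptional if it is indecomposable, $\mathrm{Hom}(M,M)\cong k$ and $\mathrm{Ext}^i(M,M)=0$ for all $i\ge 1$. A pair $(M,N)$ of exceptional modules is an exceptional pair if $\mathrm{Hom}(N,M)=0$ and $\mathrm{Ext}^i(N,M)=0$ for all $i\ge 1$. A sequence $(M_1,\dots,M_t)$ of exceptional modules is an exceptional sequence if $(M_i,M_j)$ is an exceptional pair for all $i<j$; it is complete if $t=n$. Entries are isomorphism classes. For $X$ appearing in $E$, $\mathrm{ind}_E(X)$ is the position of $X$ in $E$. $P(X)$, $I(X)$ denote projective cover and injective envelope; $\Omega^i(X)$ and $\Sigma^i(X)$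 denote the $i$-th syzygy of the (minimal) projective resolution and the $i$-th (co)syzygy of the (minimal) injective resolution of $X$, with $\Omega^0(X)=\Sigma^0(X)=X$. For a simple module $S$, the projective $t$-chain of $S$ is $\mathcal P_t(S)=(P(\Omega^{t}(S)),P(\Omega^{t-1}(S)),\dots,P(\Omega(S)),P(S),S)$ for $0\le t\le \mathrm{pdim}\,S-1$, and the injective $t$-chain of $S$ is $\mathcal I_t(S)=(S,I(S),I(\Sigma(S)),\dots,I(\Sigma^{t}(S)))$ for $0\le t\le \mathrm{indim}\,S-1$, where $\mathrm{pdim}$ and $\mathrm{indim}$ are projective and injective dimension. For a nonsimple module $M$ in $E$ and a simple module $S$, ''$E$ contains the chain from $S$ to $M$'' means that for some $t$ either $M\cong P(\Omega^t(S))$ and all modules of $\mathcal P_t(S)$ occur in $E$, or $M\cong I(\Sigma^t(S))$ and all modules of $\mathcal I_t(S)$ occur in $E$. For a complete exceptional sequence $E=(E_1,\dots,E_n)$, define $\Phi_E(E_i)=i$ if $E_i$ is simple, and $\Phi_E(E_i)=\mathrm{ind}_E(S)$ if $E_i$ is nonsimple, where $S$ is the simple module in $E$ such that $E$ contains the (projective or injective) chain from $S$ to $E_i$ (there is exactly one such $S$). *)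

(* Defs.v *)
From HB Require Import structures.
From mathcomp Require Import all_boot all_algebra generic_quotient.
From mathcomp Require Import boolp classical_sets functions.

Set Implicit Arguments.
Unset Strict Implicit.
Unset Printing Implicit Defensive.

Import GRing.Theory.

Local Open Scope ring_scope.
Local Open Scope quotient_scope.
Local Open Scope classical_set_scope.

(* Finite-dimensional modules over Lambda_n = kQ/rad^2, as representations of
   Q = (0 -> 1 -> ... -> n-1): vertices are 'I_n, numbered from 0.  The space
   at vertex i is 'rV[k]_(dim i), and maps act on row vectors by right
   multiplication.  [arr i j] is the action of the arrow i -> j; it is
   required to be 0 when Q has no such arrow, so the only data are the
   matrices [arr i j] with j = i + 1. *)
Record rep (k : fieldType) (n : nat) := Rep {
  dim : 'I_n -> nat;
  arr : forall i j : 'I_n, 'M[k]_(dim i, dim j);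
  arr_supp : forall i j : 'I_n, nat_of_ord j != i.+1 -> arr i j = 0;
  arr_rad2 : forall i j l : 'I_n, arr i j *m arr j l = 0 }.

Section Representations.
Context {k : fieldType} {n : nat}.
Implicit Types M N L : rep k n.

Record hom M N := Hom {
  hom_val :> forall i : 'I_n, 'M[k]_(dim M i, dim N i);
  hom_comm : forall i j : 'I_n, arr M i j *m hom_val j = hom_val i *m arr N i j }.

Lemma hom_eqP M N (f g : hom M N) : (forall i, f i = g i) -> f = g.
Proof.
case: f g => [f cf] [g cg] /= fg.
have e : f = g by apply: functional_extensionality_dep.
by case: _ / e cg => cg; congr Hom; apply: Prop_irrelevance.
Qed.

HB.instance Definition _ M N := gen_eqMixin (hom M N).
HB.instance Definition _ M N := gen_choiceMixin (hom M N).

Definition hom0 M N : hom M N.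
Proof. by exists (fun=> 0) => i j; rewrite mulmx0 mul0mx. Defined.

Definition hom_opp M N (f : hom M N) : hom M N.
Proof. by exists (fun i => - f i) => i j; rewrite mulmxN mulNmx hom_comm. Defined.

Definition hom_add M N (f g : hom M N) : hom M N.
Proof.
by exists (fun i => f i + g i) => i j; rewrite mulmxDr mulmxDl !hom_comm.
Defined.

Definition hom_scale M N (c : k) (f : hom M N) : hom M N.
Proof.
by exists (fun i => c *: f i) => i j; rewrite -scalemxAr -scalemxAl hom_comm.
Defined.

Lemma hom_addA M N : associative (@hom_add M N).
Proof. by move=> f g h; apply: hom_eqP => i /=; rewrite addrA. Qed.

Lemma hom_addC M N : commutative (@hom_add M N).
Proof. by move=> f g; apply: hom_eqP => i /=; rewrite addrC. Qed.

Lemma hom_add0 M N : left_id (hom0 M N) (@hom_add M N).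
Proof. by move=> f; apply: hom_eqP => i /=; rewrite add0r. Qed.

Lemma hom_addN M N : left_inverse (hom0 M N) (@hom_opp M N) (@hom_add M N).
Proof. by move=> f; apply: hom_eqP => i /=; rewrite addNr. Qed.

HB.instance Definition _ M N :=
  GRing.isZmodule.Build (hom M N)
    (@hom_addA M N) (@hom_addC M N) (@hom_add0 M N) (@hom_addN M N).

Lemma hom_scaleA M N a b (f : hom M N) :
  hom_scale a (hom_scale b f) = hom_scale (a * b) f.
Proof. by apply: hom_eqP => i /=; rewrite scalerA. Qed.

Lemma hom_scale1 M N : left_id 1 (@hom_scale M N).
Proof. by move=> f; apply: hom_eqP => i /=; rewrite scale1r. Qed.

Lemma hom_scaleDr M N : right_distributive (@hom_scale M N) +%R.
Proof. by move=> a f g; apply: hom_eqP => i /=; rewrite scalerDr. Qed.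

Lemma hom_scaleDl M N (f : hom M N) :
  {morph (fun a => hom_scale a f) : a b / a + b}.
Proof. by move=> a b; apply: hom_eqP => i /=; rewrite scalerDl. Qed.

HB.instance Definition _ M N :=
  GRing.Zmodule_isLmodule.Build k (hom M N)
    (@hom_scaleA M N) (@hom_scale1 M N) (@hom_scaleDr M N) (@hom_scaleDl M N).

Definition hom_id M : hom M M.
Proof. by exists (fun=> 1%:M) => i j; rewrite mulmx1 mul1mx. Defined.

(* Diagrammatic order: first f, then g. *)
Definition hom_comp M N L (f : hom M N) (g : hom N L) : hom M L.
Proof.
by exists (fun i => f i *m g i) => i j; rewrite mulmxA hom_comm -!mulmxA hom_comm.
Defined.

Definition mono M N (f : hom M N) := forall i, row_free (f i).
Definition epi M N (f : hom M N) := forall i, row_full (f i).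
Definition exact M N L (f : hom M N) (g : hom N L) :=
  forall i, (f i :=: kermx (g i))%MS.

Definition iso M N :=
  exists (f : hom M N) (g : hom N M),
    hom_comp f g = hom_id M /\ hom_comp g f = hom_id N.

Definition is_zero M := forall i, dim M i = 0%N.

Definition dsum M N : rep k n.
Proof.
exists (fun i => dim M i + dim N i)%N
  (fun i j => block_mx (arr M i j) 0 0 (arr N i j)) => [i j nij|i j l].
  by rewrite !arr_supp // block_mx0.
by rewrite mulmx_block !mulmx0 !mul0mx !arr_rad2 !addr0 block_mx0.
Defined.

Definition simple M :=
  ~ is_zero M /\ forall L (f : hom L M), mono f -> is_zero L \/ epi f.

Definition indecomposable M :=
  ~ is_zero M /\ forall N L, iso M (dsum N L) -> is_zero N \/ is_zero L.

Definition is_projective P :=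
  forall M N (g : hom M N) (f : hom P N), epi g ->
    exists h : hom P M, hom_comp h g = f.

Definition is_injective I :=
  forall M N (g : hom M N) (f : hom M I), mono g ->
    exists h : hom N I, hom_comp g h = f.

Record proj_res M := ProjRes {
  pr_obj :> nat -> rep k n;
  pr_d : forall i, hom (pr_obj i.+1) (pr_obj i);
  pr_aug : hom (pr_obj 0) M;
  pr_proj : forall i, is_projective (pr_obj i);
  pr_epi : epi pr_aug;
  pr_exact0 : exact (pr_d 0) pr_aug;
  pr_exact : forall i, exact (pr_d i.+1) (pr_d i) }.

Record inj_res M := InjRes {
  ir_obj :> nat -> rep k n;
  ir_d : forall i, hom (ir_obj i) (ir_obj i.+1);
  ir_aug : hom M (ir_obj 0);
  ir_inj : forall i, is_injective (ir_obj i);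
  ir_mono : mono ir_aug;
  ir_exact0 : exact ir_aug (ir_d 0);
  ir_exact : forall i, exact (ir_d i) (ir_d i.+1) }.

(* Ext^(i+1)(M, N) = 0: for the complex Hom(R, N), R a projective resolution
   of M, every cocycle in degree i+1 is a coboundary.  The condition does not
   depend on the choice of R. *)
Definition ExtS_vanishes (i : nat) M N :=
  forall (R : proj_res M) (f : hom (R i.+1) N),
    hom_comp (pr_d R i.+1) f = 0 -> exists g : hom (R i) N, f = hom_comp (pr_d R i) g.

Definition exceptional M :=
  [/\ indecomposable M,
      exists phi : {linear k^o -> hom M M}, bijective phi
    & forall i, ExtS_vanishes i M M].

Definition exceptional_pair M N :=
  [/\ exceptional M, exceptional N, forall f : hom N M, f = 0
    & forall i, ExtS_vanishes i N M].

(* [lt_pdim t M] is t < pdim M, i.e. M has no projective resolution of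
   length at most t; similarly for [lt_indim]. *)
Definition lt_pdim (t : nat) M :=
  ~ exists R : proj_res M, forall i, (t < i)%N -> is_zero (R i).

Definition lt_indim (t : nat) M :=
  ~ exists R : inj_res M, forall i, (t < i)%N -> is_zero (R i).

(* p is an epimorphism from a projective with superfluous kernel. *)
Definition is_proj_cover P M (p : hom P M) :=
  [/\ is_projective P, epi p
    & forall Q (h : hom Q P), epi (hom_comp h p) -> epi h].

(* u is an essential monomorphism into an injective. *)
Definition is_inj_envelope M I (u : hom M I) :=
  [/\ is_injective I, mono u
    & forall Q (h : hom I Q), mono (hom_comp u h) -> mono h].

Definition is_syzygy K M :=
  exists P (p : hom P M) (u : hom K P),
    [/\ is_proj_cover p, mono u & exact u p].

Definition is_cosyzygy C M :=
  exists I (u : hom M I) (p : hom I C),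
    [/\ is_inj_envelope u, epi p & exact u p].

Lemma iso_refl M : iso M M.
Proof.
exists (hom_id M), (hom_id M); split;
by apply: hom_eqP => i /=; rewrite mulmx1.
Qed.

Lemma iso_sym M N : iso M N -> iso N M.
Proof. by case=> f [g [fg gf]]; exists g, f. Qed.

Lemma iso_trans N M L : iso M N -> iso N L -> iso M L.
Proof.
move=> [f [f' [ff' f'f]]] [g [g' [gg' g'g]]].
have comp_at A B C (u : hom A B) (v : hom B C) w i :
  hom_comp u v = w -> u i *m v i = w i by move=> <-.
exists (hom_comp f g), (hom_comp g' f'); split; apply: hom_eqP => i /=.
  rewrite mulmxA -(mulmxA (f i)) (comp_at _ _ _ _ _ _ i gg') /= mulmx1.
  exact: comp_at ff'.
rewrite mulmxA -(mulmxA (g' i)) (comp_at _ _ _ _ _ _ i f'f) /= mulmx1.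
exact: comp_at g'g.
Qed.

End Representations.

HB.instance Definition _ k n := gen_eqMixin (rep k n).
HB.instance Definition _ k n := gen_choiceMixin (rep k n).

Section IsoClasses.
Context {k : fieldType} {n : nat}.

Definition isob (M N : rep k n) : bool := `[< iso M N >].

Lemma isob_refl : reflexive isob.
Proof. by move=> M; apply/asboolP; apply: iso_refl. Qed.

Lemma isob_sym : ssrbool.symmetric isob.
Proof. by move=> M N; apply/asboolP/asboolP; apply: iso_sym. Qed.

Lemma isob_trans : ssrbool.transitive isob.
Proof. by move=> N M L /asboolP MN /asboolP NL; apply/asboolP/(iso_trans MN). Qed.

Canonical iso_equiv := EquivRel isob isob_refl isob_sym isob_trans.

End IsoClasses.

Definition isoclass (k : fieldType) (n : nat) := {eq_quot (@iso_equiv k n)}.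

HB.instance Definition _ k n := Choice.on (isoclass k n).

Section ExceptionalSequences.
Context {k : fieldType} {n : nat}.
Implicit Types X Y S : isoclass k n.

(* A chosen representative; every notion applied to it below is
   isomorphism-invariant. *)
Definition module_of X : rep k n := repr X.
Coercion module_of : isoclass >-> rep.

(* P(X), I(X), Omega(X), Sigma(X), each the unique isomorphism class with the
   defining property. *)
Definition P_ X : isoclass k n :=
  xget X [set Y : isoclass k n | exists p : hom Y X, is_proj_cover p].
Definition I_ X : isoclass k n :=
  xget X [set Y : isoclass k n | exists u : hom X Y, is_inj_envelope u].
Definition Omega (t : nat) : isoclass k n -> isoclass k n :=
  iter t (fun X => xget X [set Y : isoclass k n | is_syzygy Y X]).
Definition Sigma (t : nat) : isoclass k n -> isoclass k n :=
  iter t (fun X => xget X [set Y : isoclass k n | is_cosyzygy Y X]).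

Definition proj_chain (t : nat) S : seq (isoclass k n) :=
  rcons [seq P_ (Omega s S) | s <- rev (iota 0 t.+1)] S.
Definition inj_chain (t : nat) S : seq (isoclass k n) :=
  S :: [seq I_ (Sigma s S) | s <- iota 0 t.+1].

Definition exceptional_seq (t : nat) (E : t.-tuple (isoclass k n)) :=
  (forall i, exceptional (tnth E i)) /\
  forall i j : 'I_t, (i < j)%N -> exceptional_pair (tnth E i) (tnth E j).

Definition complete_exceptional : set (n.-tuple (isoclass k n)) :=
  [set E | exceptional_seq E].

Definition contains_chain (E : n.-tuple (isoclass k n)) S X :=
  exists t : nat,
    [/\ lt_pdim t S, X = P_ (Omega t S) & {subset proj_chain t S <= E}] \/
    [/\ lt_indim t S, X = I_ (Sigma t S) & {subset inj_chain t S <= E}].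

(* Positions are numbered from 0.  For E_i nonsimple the value is the position
   of the simple module S of E with a chain from S to E_i; the default i of
   [xget] is never used when E is complete exceptional. *)
Definition Phi (E : n.-tuple (isoclass k n)) : {ffun 'I_n -> 'I_n} :=
  [ffun i =>
    if `[< simple (tnth E i) >] then i
    else xget i [set j | simple (tnth E j) /\
                         contains_chain E (tnth E j) (tnth E i)]].

End ExceptionalSequences.

Arguments complete_exceptional : clear implicits.
Arguments Phi : clear implicits.

(* Main.v *)
(** Write [m] and [m, m+1] as in the statement.  Using the exact sequences
    0 -> [m+1] -> [m, m+1] -> [m] -> 0, whose middle term is projective and
    injective for 0 < m < n, dimension shifting decides which pairs of
    indecomposables are exceptional: in a sequence the simples increase,
    [m+1, m+2] precedes [m, m+1], [m, m+1] precedes [m], and [m+1] precedes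
    [m, m+1].  If [a], [a'] with a < a' and all [c, c+1] with a <= c < a' occurred,
    these relations would give a cycle, so at least one [c, c+1] is missing
    between consecutive simples; in a sequence of length n exactly one is,
    so each nonsimple term is joined by a chain to exactly one simple.

    Give each term a slot: b for [b], and for [b, b+1] chained to [a] it is
    b + 1 if a <= b and b otherwise.  The slots are 1, ..., n, and they are
    ordered by the value of f = Phi(E), with each fibre read backwards.  Hence
    the idempotent function f determines the slots, and the term at position i
    with slot s is [s], [s-1, s] or [s, s+1] according to whether i = f(i),
    i < f(i) or i > f(i). *)
From HB Require Import structures.
Require Import Defs.
From mathcomp Require Import all_boot all_algebra generic_quotient.
From mathcomp Require Import boolp classical_sets functions.
From mathcomp Require Import zify.

Set Implicit Arguments.
Unset Strict Implicit.
Unset Printing Implicit Defensive.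

Import GRing.Theory.
Import Defs.

Local Open Scope classical_set_scope.
Local Open Scope ring_scope.

Notation "f >>> g" := (hom_comp f g) (at level 40, left associativity).

(** * Matrices between spaces of dimension at most one *)

Section Matrices.
Context {k : fieldType}.

Lemma mx_thin_row p q (A : 'M[k]_(p, q)) : p = 0%N -> A = 0.
Proof. by move=> p0; subst p; rewrite flatmx0. Qed.

Lemma mx_thin_col p q (A : 'M[k]_(p, q)) : q = 0%N -> A = 0.
Proof. by move=> q0; subst q; rewrite thinmx0. Qed.

Lemma const_mx0 p q : const_mx 0 = 0 :> 'M[k]_(p, q).
Proof. by apply/matrixP => i j; rewrite !mxE. Qed.

(** Constant matrices act as scalars between spaces of dimension at most one, with no cast between
    dimensions that are only provably equal. For [q] at most 1, the factor [q%:R] records whether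
    the middle space is zero. *)
Lemma mul_const_mx p q r (a b : k) :
  (const_mx a : 'M_(p, q)) *m (const_mx b : 'M_(q, r)) = const_mx (a * b * q%:R).
Proof.
apply/matrixP => i j; rewrite !mxE.
under eq_bigr do rewrite !mxE.
by rewrite sumr_const card_ord mulr_natr.
Qed.

Lemma const1_mx1 p : (p <= 1)%N -> const_mx 1 = 1%:M :> 'M[k]_p.
Proof.
case: p => [|[|//]] _; first by rewrite flatmx0 [RHS]flatmx0.
by apply/matrixP => i j; rewrite !mxE !ord1.
Qed.

Lemma const1_retract p q :
  (p <= 1)%N -> q = 1%N -> (const_mx 1 : 'M_(p, q)) *m (const_mx 1 : 'M_(q, p)) = 1%:M :> 'M[k]_p.
Proof. by move=> p1 ->; rewrite mul_const_mx !mulr1 const1_mx1. Qed.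

Lemma mulmx_const1 p q r (A : 'M[k]_(p, q)) :
  q = 1%N -> r = 1%N -> A *m (const_mx 1 : 'M_(q, r)) = 0 -> A = 0.
Proof. by move=> q1 r1; subst q r; rewrite const1_mx1 // mulmx1. Qed.

Lemma mulconst1_mx p q r (A : 'M[k]_(p, q)) :
  p = 1%N -> r = 1%N -> (const_mx 1 : 'M_(r, p)) *m A = 0 -> A = 0.
Proof. by move=> q1 r1; subst p r; rewrite const1_mx1 // mul1mx. Qed.

Lemma rank_const1 p q :
  (p <= 1)%N -> (q <= 1)%N -> \rank (const_mx 1 : 'M[k]_(p, q)) = minn p q.
Proof.
case: p => [|[|//]] _; first by rewrite flatmx0 mxrank0 min0n.
case: q => [|[|//]] _; first by rewrite thinmx0 mxrank0 minn0.
by rewrite const1_mx1 // mxrank1.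
Qed.

Lemma row_free_thin p q (A : 'M[k]_(p, q)) :
  (p <= 1)%N -> (p = 1%N -> A <> 0) -> row_free A.
Proof.
move=> p1 A0; have := rank_leq_row A; rewrite /row_free.
have := mxrank_eq0 A.
case: p p1 A A0 => [|[|//]] _ A A0; first by move=> _; lia.
case: (A =P 0) => [/(A0 erefl)[]|_]; by case: (\rank A) => [|[|]].
Qed.

Lemma row_full_thin p q (A : 'M[k]_(p, q)) :
  (q <= 1)%N -> (q = 1%N -> A <> 0) -> row_full A.
Proof.
move=> p1 A0; have := rank_leq_col A; rewrite /row_full.
have := mxrank_eq0 A.
case: q p1 A A0 => [|[|//]] _ A A0; first by move=> _; lia.
case: (A =P 0) => [/(A0 erefl)[]|_]; by case: (\rank A) => [|[|]].
Qed.

Lemma row_full_inj p q r (A : 'M[k]_(p, q)) (B C : 'M[k]_(q, r)) :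
  row_full A -> A *m B = A *m C -> B = C.
Proof. by move=> /row_fullP[D DA] /(congr1 (mulmx D)); rewrite !mulmxA DA !mul1mx. Qed.

(** The rows of [A *m pinvmx A - 1%:M] lie in the kernel of [A], so [B] kills them. *)
Lemma ker_factor p q r (A : 'M[k]_(p, q)) (B : 'M[k]_(p, r)) :
  kermx A *m B = 0 -> A *m (pinvmx A *m B) = B.
Proof.
move=> kB; apply/eqP; rewrite mulmxA -subr_eq0 -{2}[B]mul1mx -mulmxBl.
have /submxP[D ->] : (A *m pinvmx A - 1%:M <= kermx A)%MS.
  by apply/sub_kermxP; rewrite mulmxBl mulmxKpV // mul1mx subrr.
by rewrite -mulmxA kB mulmx0.
Qed.

End Matrices.

(** * Homomorphisms of representations *)

Section Homs.
Context {k : fieldType} {n : nat}.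
Implicit Types M N L P I A B K X Y Z : rep k n.

Lemma comp_at M N L (f : hom M N) (g : hom N L) h i :
  f >>> g = h -> f i *m g i = h i.
Proof. by move=> <-. Qed.

Lemma hom_compA M N L P (f : hom M N) (g : hom N L) (h : hom L P) :
  f >>> (g >>> h) = f >>> g >>> h.
Proof. by apply: hom_eqP => i /=; rewrite mulmxA. Qed.

Lemma comp_id M N (f : hom M N) : f >>> hom_id N = f.
Proof. by apply: hom_eqP => i /=; rewrite mulmx1. Qed.

Lemma id_comp M N (f : hom M N) : hom_id M >>> f = f.
Proof. by apply: hom_eqP => i /=; rewrite mul1mx. Qed.

Lemma comp0 M N L (f : hom M N) : f >>> (0 : hom N L) = 0.
Proof. by apply: hom_eqP => i /=; rewrite mulmx0. Qed.

Lemma comp0l M N L (f : hom N L) : (0 : hom M N) >>> f = 0.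
Proof. by apply: hom_eqP => i /=; rewrite mul0mx. Qed.

Lemma compBr M N L (f : hom M N) (g h : hom N L) : f >>> (g - h) = f >>> g - f >>> h.
Proof. by apply: hom_eqP => i /=; rewrite mulmxDr mulmxN. Qed.

Lemma compBl M N L (f g : hom M N) (h : hom N L) : (f - g) >>> h = f >>> h - g >>> h.
Proof. by apply: hom_eqP => i /=; rewrite mulmxDl mulNmx. Qed.

Lemma compZr M N L c (f : hom M N) (g : hom N L) : f >>> (c *: g) = c *: (f >>> g).
Proof. by apply: hom_eqP => i /=; rewrite -scalemxAr. Qed.

Lemma compZl M N L c (f : hom M N) (g : hom N L) : (c *: f) >>> g = c *: (f >>> g).
Proof. by apply: hom_eqP => i /=; rewrite -scalemxAl. Qed.

Lemma hom_at0 M N i : (0 : hom M N) i = 0. Proof. by []. Qed.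

Lemma mono_cancel M N L (f : hom M N) (g h : hom L M) : mono f -> g >>> f = h >>> f -> g = h.
Proof. by move=> mf e; apply: hom_eqP => i; apply: (row_free_inj (mf i)); apply: (comp_at i e). Qed.

Lemma epi_cancel M N L (f : hom M N) (g h : hom N L) : epi f -> f >>> g = f >>> h -> g = h.
Proof. by move=> ef e; apply: hom_eqP => i; apply: (row_full_inj (ef i)); apply: (comp_at i e). Qed.

Lemma mono_comp M N L (f : hom M N) (g : hom N L) : mono f -> mono g -> mono (f >>> g).
Proof.
move=> mf mg i /=; have /row_freeP[f' ff'] := mf i; have /row_freeP[g' gg'] := mg i.
by apply/row_freeP; exists (g' *m f'); rewrite mulmxA -(mulmxA (f i)) gg' mulmx1.
Qed.

Lemma epi_comp M N L (f : hom M N) (g : hom N L) : epi f -> epi g -> epi (f >>> g).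
Proof.
move=> mf mg i /=; have /row_fullP[f' ff'] := mf i; have /row_fullP[g' gg'] := mg i.
by apply/row_fullP; exists (g' *m f'); rewrite mulmxA -(mulmxA g') ff' mulmx1.
Qed.

Lemma mono_split M N (f : hom M N) g : f >>> g = hom_id M -> mono f.
Proof. by move=> fg i; apply/row_freeP; exists (g i); apply: (comp_at i fg). Qed.

Lemma epi_split M N (f : hom M N) g : f >>> g = hom_id M -> epi g.
Proof. by move=> fg i; apply/row_fullP; exists (f i); apply: (comp_at i fg). Qed.

Lemma iso_dim M N i : iso M N -> dim M i = dim N i.
Proof.
move=> [f [g [fg gf]]]; have /eqP rf := mono_split fg i; have /eqP rg := mono_split gf i.
have := rank_leq_col (f i); have := rank_leq_col (g i); rewrite rf rg; lia.
Qed.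

Lemma iso_zero M N : iso M N -> is_zero M -> is_zero N.
Proof. by move=> MN z i; rewrite -(iso_dim i MN). Qed.

Lemma mono_dim M N (f : hom M N) i : mono f -> (dim M i <= dim N i)%N.
Proof. by move=> /(_ i)/eqP <-; apply: rank_leq_col. Qed.

Lemma epi_dim M N (f : hom M N) i : epi f -> (dim N i <= dim M i)%N.
Proof. by move=> /(_ i)/eqP <-; apply: rank_leq_row. Qed.

Lemma factor_mono K P L (u : hom K P) (f : hom L P) :
  mono u -> (forall i, f i <= u i)%MS -> exists g : hom L K, g >>> u = f.
Proof.
move=> mu fu.
have c i j : arr L i j *m (f j *m pinvmx (u j)) = f i *m pinvmx (u i) *m arr K i j.
  apply: (row_free_inj (mu j)); rewrite /= -[LHS]mulmxA mulmxKpV //.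
  by rewrite -[RHS]mulmxA [arr K i j *m _]hom_comm [RHS]mulmxA mulmxKpV // hom_comm.
by exists (Hom c); apply: hom_eqP => i /=; rewrite mulmxKpV.
Qed.

Lemma factor_epi K P X Y (u : hom K P) (p : hom P X) (g : hom P Y) :
  epi p -> exact u p -> u >>> g = 0 -> exists h : hom X Y, p >>> h = g.
Proof.
move=> ep ex ug.
have key i : p i *m (pinvmx (p i) *m g i) = g i.
  apply: ker_factor; apply/eqP; rewrite -submx0 -(eqmxMr _ (ex i)) submx0; apply/eqP.
  exact: (comp_at i ug).
have c i j : arr X i j *m (pinvmx (p j) *m g j) = pinvmx (p i) *m g i *m arr Y i j.
  apply: (row_full_inj (ep i)); rewrite mulmxA -hom_comm -mulmxA key.
  by rewrite [RHS]mulmxA key hom_comm.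
by exists (Hom c); apply: hom_eqP => i /=; rewrite key.
Qed.

Lemma factor_ker K P X L (u : hom K P) (p : hom P X) (f : hom L P) :
  mono u -> exact u p -> f >>> p = 0 -> exists g : hom L K, g >>> u = f.
Proof.
move=> mu ex fp; apply: factor_mono => // i; rewrite ex; apply/sub_kermxP.
exact: (comp_at i fp).
Qed.

Lemma exact_comp0 K P X (u : hom K P) (p : hom P X) : exact u p -> u >>> p = 0.
Proof. by move=> ex; apply: hom_eqP => i /=; apply/sub_kermxP; rewrite ex. Qed.

Lemma bij_iso M N (f : hom M N) : mono f -> epi f -> iso M N.
Proof.
move=> mf ef; have [|g gf] := @factor_mono _ _ _ f (hom_id N) mf.
  by move=> i; apply: submx_full.
exists f, g; split=> //; apply: (mono_cancel mf).
by rewrite -hom_compA gf comp_id id_comp.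
Qed.

Lemma mono_iso M N (f : hom M N) : mono f -> (forall i, dim N i <= dim M i)%N -> iso M N.
Proof.
move=> mf d; apply: (bij_iso mf) => i; have /eqP r := mf i.
by rewrite /row_full r eqn_leq d (mono_dim _ mf).
Qed.

Lemma epi_iso M N (f : hom M N) : epi f -> (forall i, dim M i <= dim N i)%N -> iso M N.
Proof.
move=> ef d; apply: (bij_iso _ ef) => i; have /eqP r := ef i.
by rewrite /row_free r eqn_leq d (epi_dim _ ef).
Qed.

Lemma exact_dim K P X (u : hom K P) (p : hom P X) i :
  mono u -> epi p -> exact u p -> dim P i = (dim K i + dim X i)%N.
Proof.
move=> /(_ i)/eqP mu /(_ i)/eqP ep ex; rewrite -{1}mu -ep ex mxrank_ker.
by have := rank_leq_row (p i); lia.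
Qed.

Lemma exact_rank K P X (u : hom K P) (p : hom P X) :
  u >>> p = 0 -> (forall i, dim P i = \rank (u i) + \rank (p i))%N -> exact u p.
Proof.
move=> up d i; apply/eqmxP; rewrite -mxrank_leqif_eq.
  by rewrite mxrank_ker; apply/eqP; have := d i; lia.
by apply/sub_kermxP/(comp_at i up).
Qed.

(** An epimorphism in front does not change an image and a monomorphism behind does not change a
    kernel. This splices short exact sequences into a resolution. *)
Lemma exact_split K P X Y Z (q : hom Y K) (u : hom K P) (p : hom P X) (v : hom X Z) :
  exact u p -> epi q -> mono v -> exact (q >>> u) (p >>> v).
Proof.
move=> ex eq mv i /=; apply: eqmx_trans (eqmxMfull _ (eq i)) _.
apply: eqmx_trans (ex i) _; apply/eqmxP/andP; split; apply/sub_kermxP.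
  by rewrite mulmxA mulmx_ker mul0mx.
by apply: (row_free_inj (mv i)); rewrite mul0mx -mulmxA mulmx_ker.
Qed.

Lemma proj_iso P P' : iso P P' -> is_projective P -> is_projective P'.
Proof.
move=> [a [b [ab ba]]] pP M N g f eg; have [h hg] := pP _ _ g (a >>> f) eg.
by exists (b >>> h); rewrite -hom_compA hg hom_compA ba id_comp.
Qed.

Lemma inj_iso I I' : iso I I' -> is_injective I -> is_injective I'.
Proof.
move=> [a [b [ab ba]]] pP M N g f eg; have [h hg] := pP _ _ g (f >>> b) eg.
by exists (h >>> a); rewrite hom_compA hg -hom_compA ba comp_id.
Qed.

Lemma mono_iso_comp A B (f : hom A B) A' B' (a : hom A' A) a' (b : hom B B') b' :
  a >>> a' = hom_id _ -> b >>> b' = hom_id _ -> mono f -> mono (a >>> f >>> b).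
Proof.
by move=> aa bb mf; apply: mono_comp (mono_split bb); apply: mono_comp (mono_split aa) mf.
Qed.

Lemma epi_iso_comp A B (f : hom A B) A' B' (a : hom A' A) a' (b : hom B B') b' :
  a' >>> a = hom_id _ -> b' >>> b = hom_id _ -> epi f -> epi (a >>> f >>> b).
Proof.
by move=> aa bb mf; apply: epi_comp (epi_split bb); apply: epi_comp (epi_split aa) mf.
Qed.

Lemma exact_iso_comp K P X K' X' (u : hom K P) (p : hom P X)
    (a : hom K' K) a' (b : hom X X') b' :
  a' >>> a = hom_id _ -> b >>> b' = hom_id _ -> exact u p -> exact (a >>> u) (p >>> b).
Proof. by move=> aa bb ex; apply: exact_split ex (epi_split aa) (mono_split bb). Qed.

(** * Covers, envelopes and invariance under isomorphism *)

Section Covers.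

Definition has_cover P X := exists p : hom P X, is_proj_cover p.
Definition has_envelope I X := exists u : hom X I, is_inj_envelope u.

Lemma has_cover_iso P P' X X' :
  iso P P' -> iso X X' -> has_cover P X -> has_cover P' X'.
Proof.
move=> PP XX [p [pP ep sp]]; have := proj_iso PP pP => pP'.
case: PP XX => a [b [ab ba]] [c [d [cd dc]]].
exists (b >>> p >>> c); split=> //; first exact: epi_iso_comp ab dc ep.
move=> Q h e.
have : epi (h >>> b >>> p).
  have := epi_comp e (epi_split cd).
  by rewrite -!hom_compA cd comp_id.
move=> /sp eh; have := epi_comp eh (epi_split ba).
by rewrite -hom_compA ba comp_id.
Qed.

(** Projectivity lifts each cover through the other, superfluity makes both lifts epimorphisms, and
    comparing dimensions makes them isomorphisms. *)
Lemma has_cover_uniq P P' X : has_cover P X -> has_cover P' X -> iso P P'.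
Proof.
move=> [p [pP ep sp]] [p' [pP' ep' sp']].
have [h hp] := pP _ _ p' p ep'; have [h' hp'] := pP' _ _ p p' ep.
have eh : epi h by apply: sp'; rewrite hp.
have eh' : epi h' by apply: sp; rewrite hp'.
by apply: (epi_iso eh) => i; apply: epi_dim eh'.
Qed.

Lemma has_envelope_iso I I' X X' :
  iso I I' -> iso X X' -> has_envelope I X -> has_envelope I' X'.
Proof.
move=> PP XX [p [pP ep sp]]; have := inj_iso PP pP => pP'.
case: PP XX => a [b [ab ba]] [c [d [cd dc]]].
exists (d >>> p >>> a); split=> //; first exact: mono_iso_comp dc ab ep.
move=> Q h e.
have : mono (p >>> (a >>> h)).
  have := mono_comp (mono_split cd) e.
  by rewrite !hom_compA cd id_comp.
move=> /sp eh; have := mono_comp (mono_split ba) eh.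
by rewrite hom_compA ba id_comp.
Qed.

Lemma has_envelope_uniq I I' X : has_envelope I X -> has_envelope I' X -> iso I I'.
Proof.
move=> [p [pP ep sp]] [p' [pP' ep' sp']].
have [h hp] := pP' _ _ p p' ep; have [h' hp'] := pP _ _ p' p ep'.
have eh : mono h by apply: sp; rewrite hp.
have eh' : mono h' by apply: sp'; rewrite hp'.
by apply: (mono_iso eh) => i; apply: mono_dim eh'.
Qed.

Lemma syzygy_iso K K' X X' : iso K K' -> iso X X' -> is_syzygy K X -> is_syzygy K' X'.
Proof.
move=> [a [a' [aa a'a]]] XX [P [p [u [[pP ep sp] mu ex]]]].
have [b [b' [bb b'b]]] := XX.
exists P, (p >>> b), (a' >>> u); split.
- split=> //; first exact: epi_comp ep (epi_split b'b).
  move=> Q h; rewrite hom_compA => e; apply: sp.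
  by have := epi_comp e (epi_split bb); rewrite -!hom_compA bb comp_id.
- exact: mono_comp (mono_split a'a) mu.
- exact: exact_iso_comp aa bb ex.
Qed.

Lemma cosyzygy_iso K K' X X' :
  iso K K' -> iso X X' -> is_cosyzygy K X -> is_cosyzygy K' X'.
Proof.
move=> [a [a' [aa a'a]]] XX [I [u [p [[pP mu sp] ep ex]]]].
have [b [b' [bb b'b]]] := XX.
exists I, (b' >>> u), (p >>> a); split.
- split=> //; first exact: mono_comp (mono_split b'b) mu.
  move=> Q h; rewrite -hom_compA => e; apply: sp.
  by have := mono_comp (mono_split bb) e; rewrite !hom_compA bb id_comp.
- exact: epi_comp ep (epi_split a'a).
- exact: exact_iso_comp bb aa ex.
Qed.

Lemma syzygy_dim K X P i : is_syzygy K X -> has_cover P X -> dim P i = (dim K i + dim X i)%N.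
Proof.
move=> [P' [p [u [cp mu ex]]]] cP.
have <- := iso_dim i (has_cover_uniq (ex_intro _ p cp) cP).
by apply: exact_dim mu _ ex; case: cp.
Qed.

Lemma cosyzygy_dim K X I i :
  is_cosyzygy K X -> has_envelope I X -> dim I i = (dim X i + dim K i)%N.
Proof.
move=> [P' [u [p [cu ep ex]]]] cP.
have <- := iso_dim i (has_envelope_uniq (ex_intro _ u cu) cP).
by apply: exact_dim _ ep ex; case: cu.
Qed.

End Covers.

Lemma proj_res_iso M M' (R : proj_res M) : iso M M' ->
  exists R' : proj_res M', pr_obj R' = pr_obj R.
Proof.
move=> [a [b [ab ba]]].
have e0 : exact (pr_d R 0) (pr_aug R >>> a).
  have := exact_iso_comp (id_comp (hom_id _)) ab (pr_exact0 R).
  by rewrite id_comp.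
by exists (ProjRes (@pr_proj _ _ _ R) (epi_comp (@pr_epi _ _ _ R) (epi_split ba))
  e0 (@pr_exact _ _ _ R)).
Qed.

Lemma inj_res_iso M M' (R : inj_res M) : iso M M' ->
  exists R' : inj_res M', ir_obj R' = ir_obj R.
Proof.
move=> [a [b [ab ba]]].
have e0 : exact (b >>> ir_aug R) (ir_d R 0).
  have := exact_iso_comp ab (id_comp (hom_id _)) (ir_exact0 R).
  by rewrite comp_id.
by exists (InjRes (@ir_inj _ _ _ R) (mono_comp (mono_split ba) (@ir_mono _ _ _ R))
  e0 (@ir_exact _ _ _ R)).
Qed.

Lemma lt_pdim_iso t M M' : iso M M' -> lt_pdim t M -> lt_pdim t M'.
Proof.
move=> MM' l [R z]; apply: l; have [R' e] := proj_res_iso R (iso_sym MM').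
by exists R'; rewrite e.
Qed.

Lemma lt_indim_iso t M M' : iso M M' -> lt_indim t M -> lt_indim t M'.
Proof.
move=> MM' l [R z]; apply: l; have [R' e] := inj_res_iso R (iso_sym MM').
by exists R'; rewrite e.
Qed.

(** Vanishing quantifies over all resolutions, so a given resolution of [M'] is turned into one of
    [M] by changing its augmentation only. *)
Lemma ExtS_vanishes_iso i M M' N N' :
  iso M M' -> iso N N' -> ExtS_vanishes i M N -> ExtS_vanishes i M' N'.
Proof.
move=> [a [b [ab ba]]] [c [d [cd dc]]] v R f df.
have e0 : exact (pr_d R 0) (pr_aug R >>> b).
  have := exact_iso_comp (id_comp (hom_id _)) ba (pr_exact0 R).
  by rewrite id_comp.
pose R' := ProjRes (@pr_proj _ _ _ R) (epi_comp (@pr_epi _ _ _ R) (epi_split ab))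
  e0 (@pr_exact _ _ _ R).
have [|g fg] := v R' (f >>> d); first by rewrite /= hom_compA df comp0l.
by exists (g >>> c); rewrite hom_compA -fg -hom_compA dc comp_id.
Qed.

Lemma simple_iso M M' : iso M M' -> simple M -> simple M'.
Proof.
move=> MM [nz s]; split; first by move=> z; apply: nz; apply: iso_zero z; apply: iso_sym.
case: MM => a [b [ab ba]] L f mf; have [|z|e] := s L (f >>> b); last 2 first.
- by left.
- right; have := epi_comp e (epi_split ba).
  by rewrite -hom_compA ba comp_id.
by apply: mono_comp mf (mono_split ba).
Qed.

(** * Bricks and exceptional modules *)

Definition brick M := ~ is_zero M /\ forall f : hom M M, exists c : k, f = c *: hom_id M.

Lemma brick_iso M M' : iso M M' -> brick M -> brick M'.
Proof.
move=> MM [nz s]; split; first by move=> z; apply: nz; apply: iso_zero z; apply: iso_sym.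
case: MM => a [b [ab ba]] f; have [c e] := s (a >>> f >>> b); exists c.
rewrite -[LHS]id_comp -ba -[LHS]comp_id -ba -!hom_compA (hom_compA f) (hom_compA a).
by rewrite (hom_compA a) e compZl id_comp compZr ba.
Qed.

Lemma dim0_scalar p (a b : k) : (a%:M = b%:M :> 'M_p) -> a <> b -> p = 0%N.
Proof.
case: p => // p /matrixP/(_ ord0 ord0); rewrite !mxE /= !mulr1n.
by move=> -> /(_ erefl).
Qed.

(** The projection of a direct sum onto [N] is a scalar that equals 1 on [N] and 0 on [L]; hence one
    of the summands is zero. *)
Lemma brick_indecomposable M : brick M -> indecomposable M.
Proof.
move=> [nz s]; split=> // N L NL.
have [nzD sD] := brick_iso NL (conj nz s).
have c i j : arr (dsum N L) i j *m block_mx 1%:M 0 0 0 =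
             block_mx 1%:M 0 0 0 *m arr (dsum N L) i j.
  by rewrite /= !mulmx_block !(mulmx0, mul0mx, mulmx1, mul1mx, addr0).
have [x e] := sD (@Hom _ _ (dsum N L) (dsum N L) (fun i => block_mx 1%:M 0 0 0) c).
have ei i : x%:M = 1%:M :> 'M_(dim N i) /\ x%:M = 0%:M :> 'M_(dim L i).
  have := congr1 (fun f : hom _ _ => f i) e => /=.
  rewrite (scalar_mx_block (dim N i) (dim L i)) scale_block_mx !scaler0.
  move=> /eq_block_mx[e1 _ _ e0]; split; first by rewrite e1 scale_scalar_mx mulr1.
  by rewrite raddf0 e0 scale_scalar_mx mulr1.
have [x0|x0] := eqVneq x 0.
  left=> i; have [h _] := ei i; apply: (dim0_scalar h).
  by rewrite x0 => /esym/eqP; rewrite oner_eq0.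
by right=> i; have [_ h] := ei i; apply: (dim0_scalar h); apply/eqP.
Qed.

Lemma id_neq0 M : ~ is_zero M -> hom_id M <> 0.
Proof.
move=> nz e; apply: nz => i; have := congr1 (fun f : hom _ _ => f i) e => /=.
rewrite -[RHS](raddf0 (@scalar_mx _ _)) => /dim0_scalar; apply.
by move/eqP; rewrite oner_eq0.
Qed.

Lemma scal_linear M : linear (fun c : k^o => (c : k) *: hom_id M).
Proof. by move=> a u v; rewrite scalerDl scalerA. Qed.

Lemma exceptionalP M : exceptional M <-> brick M /\ forall i, ExtS_vanishes i M M.
Proof.
split=> [[[nz _] [phi [psi phiK psiK]] v]|[bM v]]; split=> //; last first.
- pose lin := GRing.isLinear.Build k k^o (hom M M) *:%R _ (scal_linear M).
  pose phi : {linear k^o -> hom M M} := HB.pack (fun c : k^o => (c : k) *: hom_id M) lin.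
  exists phi; have [nz s] := bM.
  have inj (a b : k) : a *: hom_id M = b *: hom_id M -> a = b.
    move=> /eqP; rewrite -subr_eq0 -scalerBl => /eqP e; apply/eqP.
    rewrite -subr_eq0; apply/negPn/negP => ab; apply: (id_neq0 nz).
    by rewrite -[LHS](scalerK ab) e scaler0.
  pose psi f := projT1 (cid (s f)).
  have psiE f : f = psi f *: hom_id M := projT2 (cid (s f)).
  exists psi => [a|f]; last by rewrite /= -psiE.
  by apply: inj; rewrite -psiE.
- exact: brick_indecomposable.
split=> // f.
(* Every endomorphism, the identity included, is a multiple of [phi 1]; dividing by the coefficient
   of the identity turns [f] into a scalar. *)
have E g : g = (psi g : k) *: (phi 1 : hom M M).
  by rewrite -[g in LHS]psiK -[psi g in LHS]mulr1; exact: (linearZ_LR phi).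
have p0 : psi (hom_id M) != 0.
  by apply/eqP => e; apply: (id_neq0 nz); rewrite [LHS]E e scale0r.
exists ((psi f : k) / (psi (hom_id M) : k)).
by rewrite {2}[hom_id M]E scalerA divfK // -E.
Qed.

Lemma exceptional_iso M M' : iso M M' -> exceptional M -> exceptional M'.
Proof.
move=> MM /exceptionalP[b v]; apply/exceptionalP; split; first exact: brick_iso b.
by move=> i; apply: ExtS_vanishes_iso (v i).
Qed.

Lemma exceptional_pair_iso M M' N N' :
  iso M M' -> iso N N' -> exceptional_pair M N -> exceptional_pair M' N'.
Proof.
move=> MM NN [eM eN h v]; split; try exact: exceptional_iso eM; try exact: exceptional_iso eN.
  case: MM NN => a [b [ab ba]] [c [d [cd dc]]] f.
  have <- : d >>> (c >>> f >>> b) >>> a = f.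
    by rewrite !hom_compA dc id_comp -hom_compA ba comp_id.
  by rewrite (h (c >>> f >>> b)) comp0 comp0l.
by move=> i; apply: ExtS_vanishes_iso (v i).
Qed.

(** The idempotent [g >>> h] is a scalar c with c h = h. Thus c = 1, as h = 0 would make [N]
    zero. *)
Lemma split_brick_iso M N (h : hom N M) (g : hom M N) :
  brick M -> ~ is_zero N -> h >>> g = hom_id N -> iso M N.
Proof.
move=> [nz s] nzN hg; have [c gh] := s (g >>> h); exists g, h; split=> //.
have : h >>> g >>> h = c *: h by rewrite -hom_compA gh compZr comp_id.
rewrite hg id_comp -{1}[h]scale1r => /eqP; rewrite -subr_eq0 -scalerBl => /eqP e.
have [c1|c1] := eqVneq (1 - c) 0.
  by rewrite gh -(subr0_eq c1) scale1r.
have h0 : h = 0 by rewrite -[LHS](scalerK c1) e scaler0.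
by case: (id_neq0 nzN); rewrite -hg h0 comp0l.
Qed.

End Homs.

(** * The indecomposable modules *)

Section Nakayama.
Context {k : fieldType} {n : nat}.
Implicit Types M N L A B C : rep k n.
Implicit Types i j : 'I_n.
Implicit Types e : bool.

(* [nak false m] is the paper's simple module [m] and [nak true m] is
   [m, m+1], with the paper's numbering from 1.  Out-of-range labels are
   convenient: [nak false 0] is zero, [nak true 0] is [1] as the injective
   envelope of [1], and [nak true n] is [n] as its own projective cover. *)
Definition nak (e : bool) (m : nat) : rep k n.
Proof.
exists (fun i : 'I_n => (i.+1 == m) + (e && (i.+1 == m.+1)))%N
  (fun i j : 'I_n => const_mx [&& e, i.+1 == m & j.+1 == m.+1]%:R) => [i j ij|i j l].
  rewrite (_ : [&& _, _ & _] = false) ?mulr0n ?const_mx0 //.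
  by apply/negP => /and3P[_ /eqP ? /eqP ?]; lia.
rewrite mul_const_mx -!natrM.
case: (boolP [&& e, i.+1 == m & j.+1 == m.+1]) => [h|_]; last by rewrite !mul0n mulr0n const_mx0.
rewrite (_ : [&& _, j.+1 == _ & _] = false); last by move: h; lia.
by rewrite muln0 mul0n mulr0n const_mx0.
Defined.

Lemma nak_dim e m i : dim (nak e m) i = ((i.+1 == m) + (e && (i.+1 == m.+1)))%N.
Proof. by []. Qed.

Lemma nak_dim_le1 e m i : (dim (nak e m) i <= 1)%N.
Proof. by rewrite nak_dim; case: eqP => [->|_]; case: e => //=; lia. Qed.

Lemma nak_arr e m i j : arr (nak e m) i j = const_mx [&& e, i.+1 == m & j.+1 == m.+1]%:R.
Proof. by []. Qed.

Lemma nak_arr0 e m i j : ~~ [&& e, i.+1 == m & j.+1 == m.+1] -> arr (nak e m) i j = 0.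
Proof. by rewrite nak_arr => /negbTE->; rewrite mulr0n const_mx0. Qed.

Lemma nak_arr1 m i j : i.+1 = m -> j.+1 = m.+1 -> arr (nak true m) i j = const_mx 1.
Proof. by rewrite nak_arr => -> ->; rewrite !eqxx. Qed.

Lemma nak0_zero : is_zero (nak false 0).
Proof. by move=> i; rewrite nak_dim; lia. Qed.

Lemma hom_from_zero M N (f g : hom M N) : is_zero M -> f = g.
Proof. by move=> z; apply: hom_eqP => i; rewrite (mx_thin_row (f i) (z i)) (mx_thin_row (g i)). Qed.

Lemma hom_to_zero M N (f g : hom M N) : is_zero N -> f = g.
Proof. by move=> z; apply: hom_eqP => i; rewrite (mx_thin_col (f i) (z i)) (mx_thin_col (g i)). Qed.

Definition homb (e' : bool) m' (e : bool) m :=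
  (m' == m) && (e ==> e') || e && (m' == m.+1).

Definition cmap e' m' e m : hom (nak e' m') (nak e m).
Proof.
exists (fun i => const_mx (homb e' m' e m)%:R) => i j.
rewrite !nak_arr !mul_const_mx.
have [h|_] := boolP (homb e' m' e m); last by rewrite mulr0 !mul0r.
have [d|d] := posnP (dim (nak e' m') i); first by rewrite [LHS]mx_thin_row // [RHS]mx_thin_row.
have [d'|d'] := posnP (dim (nak e m) j); first by rewrite [LHS]mx_thin_col // [RHS]mx_thin_col.
rewrite -!natrM; congr const_mx; congr (_%:R).
move: d d'; rewrite !nak_dim.
case/orP: h => [/andP[/eqP-> ]|/andP[-> /eqP->]]; case: e'; rewrite ?implybF => //.
all: try (case: e => //).
all: repeat (case: eqP => ? //=); lia.
Defined.

Lemma cmapE e' m' e m i : homb e' m' e m -> cmap e' m' e m i = const_mx 1.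
Proof. by move=> h /=; rewrite h. Qed.

(** The arrow of [m, m+1] carries its top onto its socle, so the value at vertex m decides the value
    at m + 1. *)
Lemma from_proj_ext m M (f g : hom (nak true m) M) :
  (0 < m)%N -> (forall i, i.+1 = m -> f i = g i) -> f = g.
Proof.
move=> m0 fg; apply: hom_eqP => i.
have [im|im] := eqVneq i.+1 m; first exact: fg.
have [im1|im1] := eqVneq i.+1 m.+1; last first.
  have d : dim (nak true m) i = 0%N by rewrite nak_dim; lia.
  by rewrite (mx_thin_row (f i)) ?(mx_thin_row (g i)).
have jn : (m.-1 < n)%N by have := ltn_ord i; lia.
pose j := Ordinal jn.
have jm : j.+1 = m by rewrite /=; lia.
apply/eqP; rewrite -subr_eq0; apply/eqP; apply: (@mulconst1_mx _ _ _ (dim (nak true m) j)).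
- by rewrite nak_dim; lia.
- by rewrite nak_dim; lia.
by rewrite mulmxBr -(nak_arr1 jm im1) !hom_comm (fg j jm) subrr.
Qed.

Lemma to_proj_ext l M (f g : hom M (nak true l)) :
  (l < n)%N -> (forall i, i.+1 = l.+1 -> f i = g i) -> f = g.
Proof.
move=> ln fg; apply: hom_eqP => i.
have [im1|im1] := eqVneq i.+1 l.+1; first exact: fg.
have [im|im] := eqVneq i.+1 l; last first.
  have d : dim (nak true l) i = 0%N by rewrite nak_dim; lia.
  by rewrite (mx_thin_col (f i)) ?(mx_thin_col (g i)).
pose j := Ordinal ln.
apply/eqP; rewrite -subr_eq0; apply/eqP; apply: (@mulmx_const1 _ _ _ (dim (nak true l) j)).
- by rewrite nak_dim; lia.
- by rewrite nak_dim /=; lia.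
by rewrite mulmxBl -(@nak_arr1 l i j im erefl) -!hom_comm (fg j erefl) subrr.
Qed.

(** Exactness of Hom([l, l+1], -) at a middle term; projectivity is the case [C] = 0. The lift is
    chosen at vertex l and carried along the arrow of [A] to l + 1. Composites of two arrows vanish,
    so it commutes with all other arrows. *)
Lemma proj_exact l A B C (u : hom A B) (v : hom B C) (f : hom (nak true l) B) :
  (0 < l)%N -> exact u v -> f >>> v = 0 -> exists g : hom (nak true l) A, g >>> u = f.
Proof.
move=> l0 ex fv.
pose phi i := f i *m pinvmx (u i).
have phiE i : phi i *m u i = f i.
  by apply: mulmxKpV; rewrite ex; apply/sub_kermxP/(comp_at i fv).
(* The sum has at most one term: it picks out the vertex labelled l, if there is one. *)
pose g i : 'M_(dim (nak true l) i, dim A i) := if i.+1 == l then phi i else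
  \sum_(j : 'I_n | j.+1 == l) (const_mx 1 : 'M_(_, dim (nak true l) j)) *m phi j *m arr A j i.
have c i j : arr (nak true l) i j *m g j = g i *m arr A i j.
  rewrite /g; case: eqP => jl.
    rewrite nak_arr0 ?mul0mx; last by lia.
    case: eqP => il; first by rewrite arr_supp ?mulmx0 //; lia.
    by rewrite mulmx_suml big1 // => j' _; rewrite -mulmxA arr_rad2 mulmx0.
  case: eqP => [il|il].
    have [jl1|jl1] := eqVneq j.+1 l.+1; last first.
      by rewrite nak_arr0 ?mul0mx ?arr_supp ?mulmx0 //; lia.
    rewrite (big_pred1 i) => [|j' /=]; last by rewrite -val_eqE /= -il eqSS.
    rewrite (nak_arr1 il jl1) -[_ *m _ *m arr _ _ _]mulmxA mulmxA.
    rewrite const1_retract ?mul1mx ?nak_dim_le1 //.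
    by rewrite nak_dim; lia.
  rewrite nak_arr0 ?mul0mx; last by lia.
  by rewrite mulmx_suml big1 // => j' _; rewrite -mulmxA arr_rad2 mulmx0.
exists (Hom c); apply: from_proj_ext => // i il /=.
by rewrite /g ifT ?phiE //; apply/eqP.
Qed.

Lemma inj_exact l A B C (u : hom A B) (v : hom B C) (f : hom B (nak true l)) :
  (l < n)%N -> exact u v -> u >>> f = 0 -> exists g : hom C (nak true l), v >>> g = f.
Proof.
move=> ln ex uf.
pose phi i := pinvmx (v i) *m f i.
have phiE i : v i *m phi i = f i.
  apply: ker_factor; apply/eqP; rewrite -submx0 -(eqmxMr _ (ex i)) submx0; apply/eqP.
  exact: (comp_at i uf).
pose g i : 'M_(dim C i, dim (nak true l) i) := if i.+1 == l.+1 then phi i else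
  \sum_(j : 'I_n | j.+1 == l.+1) arr C i j *m phi j *m (const_mx 1 : 'M_(dim (nak true l) j, _)).
have c i j : arr C i j *m g j = g i *m arr (nak true l) i j.
  rewrite /g; case: (i.+1 =P l.+1) => il.
    rewrite nak_arr0 ?mulmx0; last by lia.
    case: eqP => jl; first by rewrite arr_supp ?mul0mx //; lia.
    by rewrite mulmx_sumr big1 // => j' _; rewrite !mulmxA arr_rad2 !mul0mx.
  case: eqP => [jl|jl].
    have [il1|il1] := eqVneq i.+1 l; last first.
      by rewrite nak_arr0 ?mulmx0 ?arr_supp ?mul0mx //; lia.
    rewrite (big_pred1 j) => [|j' /=]; last by rewrite -val_eqE /= -jl eqSS.
    rewrite (nak_arr1 il1 jl) -[RHS]mulmxA const1_retract ?mulmx1 ?nak_dim_le1 //.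
    by rewrite nak_dim; lia.
  rewrite nak_arr0 ?mulmx0; last by lia.
  by rewrite mulmx_sumr big1 // => j' _; rewrite !mulmxA arr_rad2 !mul0mx.
exists (Hom c); apply: to_proj_ext => // i il /=.
by rewrite /g ifT ?phiE //; apply/eqP.
Qed.

Lemma nak_projective l : (0 < l)%N -> is_projective (nak true l).
Proof.
move=> l0 M N g f eg.
apply: (@proj_exact l _ _ (nak false 0) g 0) => //; last by apply: hom_to_zero nak0_zero.
apply: exact_rank => [|i]; first by apply: hom_to_zero nak0_zero.
by rewrite hom_at0 mxrank0 addn0 (eqP (eg i)).
Qed.

Lemma nak_injective l : (l < n)%N -> is_injective (nak true l).
Proof.
move=> ln M N g f mg.
apply: (@inj_exact l (nak false 0) _ _ 0 g) => //; last by apply: hom_from_zero nak0_zero.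
apply: exact_rank => [|i]; first by apply: hom_from_zero nak0_zero.
by rewrite hom_at0 mxrank0 (eqP (mg i)).
Qed.

Definition iota_ l : hom (nak false l.+1) (nak true l) := cmap _ _ _ _.
Definition pi_ l : hom (nak true l) (nak false l) := cmap _ _ _ _.

Lemma iota_at l i : iota_ l i = const_mx 1.
Proof. by apply: cmapE; rewrite /homb eqxx orbT. Qed.

Lemma pi_at l i : pi_ l i = const_mx 1.
Proof. by apply: cmapE; rewrite /homb eqxx. Qed.

Lemma iota_mono l : mono (iota_ l).
Proof.
move=> i; rewrite iota_at /row_free rank_const1 ?nak_dim_le1 // !nak_dim /=; lia.
Qed.

Lemma pi_epi l : epi (pi_ l).
Proof.
move=> i; rewrite pi_at /row_full rank_const1 ?nak_dim_le1 // !nak_dim /=; lia.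
Qed.

Lemma iota_pi_exact l : exact (iota_ l) (pi_ l).
Proof.
apply: exact_rank => [|i].
  apply: hom_eqP => i /=; rewrite mul_const_mx.
  have [e|e] := eqVneq i.+1 l; [apply: mx_thin_row|apply: mx_thin_col]; rewrite /=; lia.
by rewrite iota_at pi_at !rank_const1 ?nak_dim_le1 // !nak_dim /=; lia.
Qed.

Lemma iota_pi l : iota_ l >>> pi_ l = 0.
Proof. exact: exact_comp0 (iota_pi_exact l). Qed.

(** At a vertex where both spaces are nonzero, either an arrow out of it is injective in the target
    and zero in the source, or an arrow into it is surjective in the source and zero in the target.
    Both force the component to vanish. *)
Lemma nak_hom0 e' m' e m (f : hom (nak e' m') (nak e m)) :
  (0 < m')%N -> (m + e <= n)%N -> ~~ homb e' m' e m -> f = 0.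
Proof.
move=> m'0 mn h; apply: hom_eqP => i; rewrite hom_at0.
have [d|d] := posnP (dim (nak e' m') i); first by apply: mx_thin_row.
have [d'|d'] := posnP (dim (nak e m) i); first by apply: mx_thin_col.
have [im|im] := eqVneq i.+1 m.
  have [im'|im'] := eqVneq i.+1 m'.
    have [e1 e'0] : e = true /\ e' = false.
      by move: h; rewrite /homb -im -im' eqxx; case: e e' {f mn d d'} => [] [].
    subst e e'.
    have jn : (m < n)%N by lia.
    pose j := Ordinal jn.
    have := hom_comm f i j; rewrite nak_arr0 // mul0mx (@nak_arr1 _ _ j im erefl).
    by move/esym; apply: mulmx_const1; rewrite nak_dim /=; lia.
  have e'1 : e' = true by move: d; rewrite nak_dim; case: e' {f h}; rewrite //=; lia.
  subst e'; have jn : (m'.-1 < n)%N by move: d (ltn_ord i); rewrite nak_dim /=; lia.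
  pose j := Ordinal jn.
  have jm' : j.+1 = m' by rewrite /=; lia.
  have im1 : i.+1 = m'.+1 by move: d; rewrite nak_dim /=; lia.
  have := hom_comm f j i; rewrite (nak_arr1 jm' im1).
  rewrite [arr (nak e m) j i]nak_arr0 ?mulmx0; last by lia.
  by apply: mulconst1_mx; rewrite nak_dim; lia.
case: e f h d' mn => [f h d' mn|f h d' mn]; last by rewrite nak_dim /= in d'; lia.
have im1 : i.+1 = m.+1 by move: d'; rewrite nak_dim /=; lia.
have [e'1 im'] : e' = true /\ i.+1 = m'.+1.
  by move: d h; rewrite nak_dim /homb; case: (e') => /=; lia.
by case/negP: h; rewrite /homb e'1; lia.
Qed.

Lemma cmap_neq0 e' m' e m :
  (0 < m' <= n)%N -> homb e' m' e m -> cmap e' m' e m <> 0.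
Proof.
move=> m'n h /(congr1 (fun f : hom _ _ => f)) E.
have jn : (m'.-1 < n)%N by lia.
pose j := Ordinal jn.
have := congr1 (fun f : hom _ _ => f j) E; rewrite /= h.
have d' : (0 < dim (nak e' m') j)%N by rewrite nak_dim /=; lia.
have d : (0 < dim (nak e m) j)%N.
  by move: h; rewrite nak_dim /homb /=; case: (e) => /=; lia.
by move/matrixP/(_ (Ordinal d') (Ordinal d)); rewrite !mxE => /eqP; rewrite oner_eq0.
Qed.

Lemma nak_nonzero e m : (0 < m <= n)%N -> ~ is_zero (nak e m).
Proof.
move=> mn z; have jn : (m.-1 < n)%N by lia.
by have := z (Ordinal jn); rewrite nak_dim /=; lia.
Qed.

Lemma nak_brick e m : (0 < m)%N -> (m + e <= n)%N -> brick (nak e m).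
Proof.
move=> m0 mn; split; first by apply: nak_nonzero; lia.
move=> f; have jn : (m.-1 < n)%N by lia.
pose j := Ordinal jn.
have dj : (0 < dim (nak e m) j)%N by rewrite nak_dim /=; lia.
exists (f j (Ordinal dj) (Ordinal dj)).
set c := f j _ _.
have key (i : 'I_n) : i.+1 = m -> f i = c *: 1%:M.
  move=> im; have -> : i = j by apply: val_inj => /=; lia.
  apply/matrixP => a b; rewrite !mxE /c.
  have u (x : 'I_(dim (nak e m) j)) : x = Ordinal dj.
    have := leq_trans (ltn_ord x) (nak_dim_le1 e m j).
    by rewrite ltnS leqn0 => /eqP x0; apply: val_inj.
  by rewrite (u a) (u b) eqxx mulr1.
case: e mn f dj @c key => mn f dj c key; first by apply: from_proj_ext.
apply: hom_eqP => i; have [/key //|im] : i.+1 = m \/ i.+1 <> m by lia.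
have d : dim (nak false m) i = 0%N by rewrite nak_dim; lia.
by rewrite (mx_thin_row (f i)) // [RHS]mx_thin_row.
Qed.

Lemma thin_iso_simple M m : (forall i, dim M i = dim (nak false m) i) -> iso M (nak false m).
Proof.
move=> d.
have a0 i j : arr M i j = 0.
  have [/eqP ij|ij] := boolP (nat_of_ord j == i.+1); last exact: arr_supp.
  have [im|im] := eqVneq i.+1 m; [apply: mx_thin_col|apply: mx_thin_row]; rewrite d nak_dim /=; lia.
have c i j : arr M i j *m const_mx 1 = const_mx 1 *m arr (nak false m) i j.
  by rewrite a0 nak_arr0 // mulmx0 mul0mx.
have c' i j : arr (nak false m) i j *m const_mx 1 = const_mx 1 *m arr M i j.
  by rewrite a0 nak_arr0 // mulmx0 mul0mx.
have e p q : p = q -> (p <= 1)%N -> (const_mx 1 : 'M[k]_(p, q)) *m const_mx 1 = 1%:M :> 'M_p.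
  by move=> <- p1; rewrite !const1_mx1 // mulmx1.
exists (Hom c), (Hom c'); split; apply: hom_eqP => i; apply: e; rewrite ?d ?nak_dim_le1 //.
Qed.

Lemma nak_simple m : (0 < m <= n)%N -> simple (nak false m).
Proof.
move=> mn; split; first exact: nak_nonzero.
move=> L f mf; have jn : (m.-1 < n)%N by lia.
pose j := Ordinal jn.
have dL i := mono_dim i mf.
have [d0|d0] := posnP (dim L j).
  left=> i; have := dL i; rewrite nak_dim.
  have [im|im] := eqVneq i.+1 m; last by move=> /=; lia.
  by have -> : i = j by apply: val_inj => /=; lia.
right=> i; apply: row_full_thin; first exact: nak_dim_le1.
move=> d1 f0; have /eqP := mf i; rewrite f0 mxrank0 => e.
have ij : i = j by apply: val_inj => /=; move: d1; rewrite nak_dim /=; lia.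
by move: d0; rewrite -ij -e.
Qed.

Lemma nak_not_simple m : (0 < m < n)%N -> ~ simple (nak true m).
Proof.
move=> mn [_ s]; have [z|e] := s _ _ (@iota_mono m).
  by apply: (@nak_nonzero false m.+1) z; lia.
have jn : (m.-1 < n)%N by lia.
by have := epi_dim (Ordinal jn) e; rewrite !nak_dim /=; lia.
Qed.

Lemma nak_iso_inj e m e' m' :
  (0 < m)%N -> (m + e <= n)%N -> (0 < m')%N -> (m' + e' <= n)%N ->
  iso (nak e m) (nak e' m') -> e = e' /\ m = m'.
Proof.
move=> m0 mn m'0 m'n I.
have D (i : nat) : (i < n)%N ->
  ((i.+1 == m) + (e && (i.+1 == m.+1)) = (i.+1 == m') + (e' && (i.+1 == m'.+1)))%N.
  by move=> h; have := iso_dim (Ordinal h) I; rewrite !nak_dim.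
move: (D m.-1) (D m'.-1) (D m) (D m'); rewrite !prednK //.
by case: e e' {I D} mn m'n => [] [] /=; lia.
Qed.

(* A vector not killed by the arrow i -> i+1 spans a copy of an injective
   module, which splits off; if all arrows vanish, any vector spans a simple
   direct summand.  A nonzero direct summand of a brick is the whole brick. *)
Lemma brick_nak M : brick M ->
  exists e m, [/\ (0 < m)%N, (m + e <= n)%N & iso M (nak e m)].
Proof.
move=> bM.
have [[i [j aij]]|a0] := pselect (exists i j, arr M i j <> 0).
  have ij : nat_of_ord j = i.+1.
    by apply/eqP/negPn/negP => /(@arr_supp _ _ M i j).
  have [r rij] : exists r, row r (arr M i j) <> 0.
    apply: contrapT => nr; apply: aij; apply/row_matrixP => r; rewrite row0.
    by apply: contrapT => rr; apply: nr; exists r.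
  have i1n : (i.+1 < n)%N by have := ltn_ord j; lia.
  exists true, i.+1; split; rewrite ?addn1 //.
  (* At vertex i this sends the generator to the r-th basis vector, which the arrow to j does not
     kill. *)
  pose x (l : 'I_n) : 'M[k]_(dim (nak true i.+1) l, dim M l) :=
    \matrix_(a, b) (nat_of_ord b == r)%:R.
  pose g (l : 'I_n) : 'M[k]_(dim (nak true i.+1) l, dim M l) := if l.+1 == i.+1 then x l else
    \sum_(l' : 'I_n | l'.+1 == i.+1) const_mx 1 *m x l' *m arr M l' l.
  have c (l1 l2 : 'I_n) : arr (nak true i.+1) l1 l2 *m g l2 = g l1 *m arr M l1 l2.
    rewrite /g; case: (l1.+1 =P i.+1) => h1; last first.
      rewrite nak_arr0 ?mul0mx; last by lia.
      by rewrite mulmx_suml big1 // => j' _; rewrite -mulmxA arr_rad2 mulmx0.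
    have [h2|h2] := eqVneq l2.+1 i.+2; last first.
      by rewrite nak_arr0 ?mul0mx ?arr_supp ?mulmx0 //; lia.
    case: eqP => [|_]; first by lia.
    rewrite (big_pred1 l1) => [|j' /=]; last by rewrite -val_eqE /= -h1 eqSS.
    rewrite (nak_arr1 h1 h2) -[_ *m _ *m arr _ _ _]mulmxA mulmxA.
    rewrite const1_retract ?mul1mx ?nak_dim_le1 //.
    by rewrite nak_dim; lia.
  pose h := Hom c.
  have hi : h i = x i by rewrite /= /g ifT.
  have hj : h j <> 0.
    move=> h0; have := hom_comm h i j.
    rewrite h0 mulmx0 => e0; apply: rij.
    have d1 : dim (nak true i.+1) i = 1%N by rewrite nak_dim; lia.
    have d0 : (0 < dim (nak true i.+1) i)%N by rewrite d1.
    have <- : row (Ordinal d0) (h i *m arr M i j) = row r (arr M i j).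
      rewrite row_mul hi; apply/rowP => b; rewrite !mxE (bigD1 r) //= !mxE eqxx mul1r.
      rewrite big1 ?addr0 // => s sr; rewrite !mxE.
      by rewrite (_ : _ == _ = false) ?mul0r //; apply/negbTE.
    by rewrite -e0 row0.
  have mh : mono h.
    move=> l; apply: row_free_thin; first exact: nak_dim_le1.
    move=> d1 hl; apply: hj.
    have [li|li] := eqVneq l.+1 i.+1.
      have il : l = i by apply: val_inj; case: li.
      subst l.
      have := hom_comm h i j; rewrite hl mul0mx.
      by rewrite nak_arr1 ?ij //; apply: mulconst1_mx; rewrite nak_dim; lia.
    suff lj : l = j by rewrite -lj.
    by apply: val_inj; move: d1; rewrite nak_dim /= => ?; lia.
  have [p hp] := nak_injective i1n (hom_id _) mh.
  by apply: (split_brick_iso bM _ hp); apply: nak_nonzero; lia.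
have a0' i j : arr M i j = 0.
  by apply: contrapT => h; apply: a0; exists i, j.
have [i di] : exists i, dim M i <> 0%N.
  by apply: contrapT => h; apply: bM.1 => i; apply: contrapT => hi; apply: h; exists i.
have r0 : (0 < dim M i)%N by lia.
exists false, i.+1; split=> //; first by rewrite addn0; apply: ltn_ord.
pose h (l : 'I_n) : 'M[k]_(dim (nak false i.+1) l, dim M l) :=
  \matrix_(a, b) (nat_of_ord b == 0)%:R.
pose g (l : 'I_n) : 'M[k]_(dim M l, dim (nak false i.+1) l) :=
  \matrix_(a, b) (nat_of_ord a == 0)%:R.
have ch (l l' : 'I_n) : arr (nak false i.+1) l l' *m h l' = h l *m arr M l l'.
  by rewrite a0' nak_arr0 // mulmx0 mul0mx.
have cg (l l' : 'I_n) : arr M l l' *m g l' = g l *m arr (nak false i.+1) l l'.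
  by rewrite a0' nak_arr0 // mulmx0 mul0mx.
apply: (@split_brick_iso _ _ _ _ (Hom ch) (Hom cg)) => //.
  by apply: nak_nonzero; have := ltn_ord i; lia.
apply: hom_eqP => l /=; apply/matrixP => a b; rewrite !mxE.
have li : l = i by apply: val_inj => /=; have := ltn_ord a; rewrite /=; lia.
subst l; have -> : a = b.
  by apply: val_inj => /=; have := ltn_ord a; have := ltn_ord b; rewrite /=; lia.
rewrite (bigD1 (Ordinal r0)) //= !mxE (eqxx b) (eqxx 0%N) mulr1.
rewrite big1 ?addr0 // => s sr; rewrite !mxE.
by rewrite (_ : _ == _ = false) ?mul0r //; apply/negbTE.
Qed.

End Nakayama.

(** * Extensions, projective and injective dimension *)

Section Resolutions.
Context {k : fieldType} {n : nat}.
Implicit Types M N L A B C : rep k n.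
Implicit Types i j : 'I_n.
Implicit Types e : bool.
Local Notation nak := (@nak k n).
Local Notation pi_ := (@pi_ k n).
Local Notation iota_ := (@iota_ k n).

(** [M] is placed before the resolution, so that degree 0 and higher degrees are treated alike. *)
Definition pr_prev M (R : proj_res M) s : rep k n := if s is s'.+1 then R s' else M.
Definition pr_prevd M (R : proj_res M) s : hom (R s) (pr_prev R s) :=
  match s with 0%N => pr_aug R | s'.+1 => pr_d R s' end.

Lemma pr_prev_exact M (R : proj_res M) s : exact (pr_d R s) (pr_prevd R s).
Proof. by case: s => [|s]; [apply: pr_exact0|apply: pr_exact]. Qed.

Definition ir_prev M (R : inj_res M) s : rep k n := if s is s'.+1 then R s' else M.
Definition ir_prevd M (R : inj_res M) s : hom (ir_prev R s) (R s) :=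
  match s with 0%N => ir_aug R | s'.+1 => ir_d R s' end.

Lemma ir_prev_exact M (R : inj_res M) s : exact (ir_prevd R s) (ir_d R s).
Proof. by case: s => [|s]; [apply: ir_exact0|apply: ir_exact]. Qed.

Lemma ext_proj s M l : (l < n)%N -> ExtS_vanishes s M (nak true l).
Proof.
by move=> ln R f df; have [g <-] := inj_exact ln (@pr_exact _ _ _ R s) df; exists g.
Qed.

(** Dimension shifting by induction on [l]. A cocycle with values in [l+1] is a coboundary of some g
    with values in the injective [l, l+1]. It is one already in [l+1] once g is corrected to vanish
    in [l]. *)
Lemma ext_simple M l : (l <= n)%N ->
  (forall l', (l' < l)%N -> forall h : hom M (nak false l'), exists h', h' >>> pi_ l' = h) ->
  forall s, ExtS_vanishes s M (nak false l).
Proof.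
move=> ln lift s R; move: ln lift s; elim: l => [|l IH] ln lift s f df.
  by exists 0; apply: hom_to_zero nak0_zero.
have [|g gf] := @inj_exact _ _ l _ _ _ _ _ (f >>> iota_ l) ln (@pr_exact _ _ _ R s).
  by rewrite hom_compA df comp0l.
have dg : pr_d R s >>> (g >>> pi_ l) = 0.
  by rewrite hom_compA gf -hom_compA iota_pi comp0.
(* In degree 0 the map to [l] comes from [M] and is lifted by hypothesis; above, it is a coboundary
   by induction and is lifted by projectivity of a term of [R]. *)
have [h hE] : exists h, pr_prevd R s >>> h >>> pi_ l = g >>> pi_ l.
  case: s {f df gf} g dg => [|s] g dg.
    have [h0 h0E] := factor_epi (@pr_epi _ _ _ R) (@pr_exact0 _ _ _ R) dg.
    have [h' hE] := lift l (leqnn _) h0.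
    by exists h'; rewrite -hom_compA hE.
  have [h0 h0E] := IH (ltnW ln) (fun l' l'l => lift l' (ltnW l'l)) s _ dg.
  have [h' hE] := pr_proj h0 (@pi_epi _ _ l).
  by exists h'; rewrite -hom_compA hE.
have [|g' g'E] := @factor_ker _ _ _ _ _ _ _ _ (g - pr_prevd R s >>> h) (@iota_mono _ _ l)
  (@iota_pi_exact _ _ l); first by rewrite compBl hE subrr.
exists g'; apply: (mono_cancel (@iota_mono _ _ l)).
rewrite -hom_compA g'E compBr gf hom_compA (exact_comp0 (@pr_prev_exact _ R s)).
by rewrite comp0l subr0.
Qed.

(** One formula covers all degrees: [nak true n] is the simple projective [n], and [nak true] of a
    larger label is zero. *)
Lemma std_resolution m : (0 < m)%N ->
  exists R : proj_res (nak false m), forall s, (R : nat -> rep k n) s = nak true (s + m).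
Proof.
move=> m0.
have p s : is_projective (nak true (s + m) ) by apply: nak_projective; lia.
have e0 : exact (pi_ m.+1 >>> iota_ m) (pi_ m).
  have := exact_split (@iota_pi_exact k n m) (@pi_epi _ _ _) (mono_split (id_comp (hom_id _))).
  by rewrite comp_id.
have ex s : exact (pi_ (s + m).+2 >>> iota_ (s + m).+1) (pi_ (s + m).+1 >>> iota_ (s + m)).
  exact: exact_split (@iota_pi_exact k n _) (@pi_epi _ _ _) (@iota_mono _ _ _).
by exists (@ProjRes _ _ _ (fun s => nak true (s + m)) (fun s => pi_ (s + m).+1 >>> iota_ (s + m))
   (pi_ m) p (@pi_epi _ _ _) e0 ex).
Qed.

(** The connecting map for 0 -> [l+1] -> [l, l+1] -> [l] -> 0, with injective middle term. If the
    image of [f] were a coboundary, [f] would itself come from a map into [l, l+1] on the previous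
    term. *)
Lemma pr_shift M (R : proj_res M) s l (f : hom (R s) (nak false l)) : (l < n)%N ->
  pr_d R s >>> f = 0 -> (forall w, pr_prevd R s >>> w >>> pi_ l <> f) ->
  exists2 f' : hom (R s.+1) (nak false l.+1),
    pr_d R s.+1 >>> f' = 0 & forall g, pr_d R s >>> g <> f'.
Proof.
move=> ln df nf; have [y yf] := pr_proj f (@pi_epi _ _ l).
have [|f' f'E] := @factor_ker _ _ _ _ _ _ _ _ (pr_d R s >>> y) (@iota_mono _ _ l)
  (@iota_pi_exact _ _ l); first by rewrite -hom_compA yf.
exists f'.
  apply: (mono_cancel (@iota_mono _ _ l)); rewrite -hom_compA f'E hom_compA.
  by rewrite (exact_comp0 (@pr_exact _ _ _ R s)) !comp0l.
move=> g gf'.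
have [|w wE] := @inj_exact _ _ l _ _ _ _ _ (y - g >>> iota_ l) ln (@pr_prev_exact _ R s).
  by rewrite compBr hom_compA gf' f'E subrr.
by apply: (nf w); rewrite wE compBl -hom_compA iota_pi comp0 subr0.
Qed.

(** The identity of [m] does not lift to [m, m+1]; shifting it s + 1 times gives a nonzero class in
    Ext^(s+1)([m], [m+s+1]). *)
Lemma pr_nonvanishing m (R : proj_res (nak false m)) s : (0 < m)%N -> (s + m < n)%N ->
  exists2 f : hom (R s.+1) (nak false (s + m).+1),
    pr_d R s.+1 >>> f = 0 & forall g, pr_d R s >>> g <> f.
Proof.
move=> m0; elim: s => [|s IH] mn.
  apply: (@pr_shift _ R 0 m (pr_aug R)) => //; first exact: exact_comp0 (@pr_exact0 _ _ _ R).
  move=> w; rewrite -hom_compA (nak_hom0 w) ?comp0l ?comp0 //; last first.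
  - by rewrite /homb; lia.
  - by lia.
  move=> e0; have := @nak_nonzero k n false m; case; first by lia.
  move=> i; have := epi_dim i (@pr_epi _ _ _ R); have /eqP := @pr_epi _ _ _ R i.
  by rewrite -e0 mxrank0 => <-.
have [|f df nf] := IH; first by lia.
by apply: (pr_shift _ df) => // w; rewrite -hom_compA; apply: nf.
Qed.

Lemma lt_pdim_simple m t : (0 < m)%N -> (t + m < n)%N -> lt_pdim t (nak false m).
Proof.
move=> m0 tm [R z]; have [f _ nf] := pr_nonvanishing R m0 tm.
by apply: (nf 0); apply: hom_from_zero; apply: z.
Qed.

Lemma ir_shift M (R : inj_res M) s l (f : hom (nak false l.+1) (R s)) : (0 < l < n)%N ->
  f >>> ir_d R s = 0 -> (forall w, iota_ l >>> (w >>> ir_prevd R s) <> f) ->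
  exists2 f' : hom (nak false l) (R s.+1),
    f' >>> ir_d R s.+1 = 0 & forall g, g >>> ir_d R s <> f'.
Proof.
move=> /andP[l0 ln] df nf; have [y yf] := ir_inj f (@iota_mono _ _ l).
have [|f' f'E] := @factor_epi _ _ _ _ _ _ (iota_ l) (pi_ l) (y >>> ir_d R s) (@pi_epi _ _ l)
  (@iota_pi_exact _ _ l); first by rewrite hom_compA yf.
exists f'.
  apply: (epi_cancel (@pi_epi _ _ l)); rewrite hom_compA f'E -hom_compA.
  by rewrite (exact_comp0 (@ir_exact _ _ _ R s)) !comp0.
move=> g gf'.
have [|w wE] := @proj_exact _ _ l _ _ _ _ _ (y - pi_ l >>> g) l0 (@ir_prev_exact _ R s).
  by rewrite compBl -hom_compA gf' f'E subrr.
by apply: (nf w); rewrite wE compBr hom_compA iota_pi comp0l subr0.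
Qed.

(** Dually, the identity of [m] does not extend to [m-1, m], and each shift lowers the simple by
    one. *)
Lemma ir_nonvanishing m (R : inj_res (nak false m)) s l : (m <= n)%N -> (0 < l)%N ->
  (l + s.+1 = m)%N -> exists2 f : hom (nak false l) (R s.+1),
    f >>> ir_d R s.+1 = 0 & forall g, g >>> ir_d R s <> f.
Proof.
move=> mn; elim: s l => [|s IH] l l0 lm.
  have ml : m = l.+1 by lia.
  clear lm; subst m; apply: (@ir_shift _ R 0 l (ir_aug R)); first by lia.
    exact: exact_comp0 (@ir_exact0 _ _ _ R).
  move=> w; rewrite (nak_hom0 w) ?comp0l ?comp0 //; last first.
  - by rewrite /homb; lia.
  - by rewrite addn0; lia.
  move=> e0; have := @nak_nonzero k n false l.+1; case; first by lia.
  move=> i; have /eqP := @ir_mono _ _ _ R i.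
  by rewrite -e0 mxrank0 => <-.
have [||f df nf] := IH l.+1; [by []|by lia|].
by apply: (ir_shift _ df) => [|w]; [by lia|rewrite hom_compA; apply: nf].
Qed.

Lemma lt_indim_simple m t : (t.+1 < m <= n)%N -> lt_indim t (nak false m).
Proof.
move=> /andP[tm mn] [R z]; have := @ir_nonvanishing m R t (m - t.+1) mn.
case; [by lia|by lia|move=> f _ nf].
by apply: (nf 0); apply: hom_to_zero; apply: z.
Qed.

Lemma nak_exceptional e m : (0 < m)%N -> (m + e <= n)%N -> exceptional (nak e m).
Proof.
move=> m0 mn; apply/exceptionalP; split; first exact: nak_brick.
case: e mn => mn; first by move=> i; apply: ext_proj; lia.
apply: ext_simple => [|l lm h]; first by lia.
rewrite (nak_hom0 h) //; first by exists 0; rewrite comp0l.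
- by lia.
- by rewrite /homb; lia.
Qed.

(** Numerical form of an exceptional pair. The first factor says that no nonzero map goes backwards;
    the second excludes the only backward extensions, those from [m'] to [m] with m' < m. *)
Definition okpair e m e' m' :=
  ~~ homb e' m' e m && [|| e, e' | (m < m')%N].

Lemma nak_pair e m e' m' :
  (0 < m)%N -> (m + e <= n)%N -> (0 < m')%N -> (m' + e' <= n)%N ->
  exceptional_pair (nak e m) (nak e' m') <-> okpair e m e' m'.
Proof.
move=> m0 mn m'0 m'n; split.
  move=> [_ _ h v]; apply/andP; split.
    by apply/negP => hb; apply: (@cmap_neq0 k n e' m' e m); [lia|by []|apply: h].
  case: e e' mn m'n h v => [] [] // mn m'n h v.
  rewrite ltnNge; apply/negP => mm.
  have [mm'|mm'] := eqVneq m' m.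
    by subst m'; apply: (@cmap_neq0 k n false m false m);
      [lia|rewrite /homb eqxx|apply: h].
  (* Refuting a statement about all resolutions requires that one exists. The class used below has
     degree m - m'. *)
  have [R _] := @std_resolution m' m'0.
  have [|f df nf] := @pr_nonvanishing m' R (m - m').-1 m'0; first by lia.
  have mE : ((m - m').-1 + m').+1 = m by lia.
  move: f df nf; rewrite mE => f df nf.
  by have [g fg] := v _ R f df; apply: (nf g).
move=> /andP[nh c]; split; try exact: nak_exceptional.
  by move=> f; apply: nak_hom0.
case: e mn nh c => mn nh c; first by move=> i; apply: ext_proj; lia.
apply: ext_simple => [|l lm h]; first by lia.
case: e' m'n nh c h => m'n nh /= c h.
  exact: (nak_projective m'0) h (@pi_epi _ _ l).
rewrite (nak_hom0 h) //; first by exists 0; rewrite comp0l.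
- by lia.
- by rewrite /homb; lia.
Qed.

(** * Covers, envelopes and syzygies of the simple modules *)

Lemma proj_cover_nak l : (0 < l)%N -> is_proj_cover (pi_ l).
Proof.
move=> l0; split; [exact: nak_projective|exact: pi_epi|move=> Q h e].
(* The map [h] is nonzero at the top because its composite with [pi_ l] is onto; the arrow of
   [l, l+1] then makes it nonzero at the socle. *)
have f0 (j : 'I_n) : j.+1 = l -> h j <> 0.
  move=> jl h0; have /eqP := e j; rewrite /= h0 mul0mx mxrank0; lia.
move=> i; apply: row_full_thin; first exact: nak_dim_le1.
move=> d1 hi; have [il|il] := eqVneq i.+1 l; first exact: f0 hi.
have il1 : i.+1 = l.+1 by move: d1; rewrite nak_dim; lia.
have jn : (l.-1 < n)%N by have := ltn_ord i; lia.
pose j := Ordinal jn; have jl : j.+1 = l by rewrite /=; lia.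
apply: (f0 j jl); have := hom_comm h j i; rewrite hi mulmx0 (nak_arr1 jl il1) => /esym.
by apply: mulmx_const1; rewrite nak_dim; lia.
Qed.

Lemma inj_envelope_nak l : (l < n)%N -> is_inj_envelope (iota_ l).
Proof.
move=> ln; split; [exact: nak_injective|exact: iota_mono|move=> Q h e].
have f0 (j : 'I_n) : j.+1 = l.+1 -> h j <> 0.
  move=> jl h0; have /eqP := e j; rewrite /= h0 mulmx0 mxrank0; lia.
move=> i; apply: row_free_thin; first exact: nak_dim_le1.
move=> d1 hi; have [il|il] := eqVneq i.+1 l.+1; first exact: f0 hi.
have il1 : i.+1 = l by move: d1; rewrite nak_dim; lia.
pose j := Ordinal ln.
apply: (f0 j erefl); have := hom_comm h i j; rewrite hi mul0mx (@nak_arr1 _ _ _ i j il1 erefl).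
by apply: mulconst1_mx; rewrite nak_dim /=; lia.
Qed.

Lemma syzygy_nak l : (0 < l)%N -> is_syzygy (nak false l.+1) (nak false l).
Proof.
move=> l0; exists (nak true l), (pi_ l), (iota_ l).
by split; [exact: proj_cover_nak|exact: iota_mono|exact: iota_pi_exact].
Qed.

Lemma cosyzygy_nak l : (l < n)%N -> is_cosyzygy (nak false l) (nak false l.+1).
Proof.
move=> ln; exists (nak true l), (iota_ l), (pi_ l).
by split; [exact: inj_envelope_nak|exact: pi_epi|exact: iota_pi_exact].
Qed.

Lemma zero_envelope M : is_zero M -> is_inj_envelope (hom_id M).
Proof.
move=> z; split.
- by move=> A B g f mg; exists 0; apply: hom_to_zero.
- exact: mono_split (id_comp (hom_id _)).
- by move=> Q h; rewrite id_comp.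
Qed.

(** Past the end of the injective resolution of a simple module the cosyzygies stay zero. *)
Lemma zero_cosyzygy M : is_zero M -> is_cosyzygy M M.
Proof.
move=> z; exists M, (hom_id M), (hom_id M); split.
- exact: zero_envelope.
- exact: epi_split (id_comp (hom_id _)).
- apply: exact_rank => [|i]; first exact: hom_to_zero.
  by have := rank_leq_row (hom_id M i); have := z i; lia.
Qed.

End Resolutions.

(** * Isomorphism classes and chains *)

Section Classes.
Context {k : fieldType} {n : nat}.
Implicit Types M N : rep k n.
Implicit Types X Y : isoclass k n.
Implicit Types e : bool.
Local Notation nak := (@nak k n).

Definition cls M : isoclass k n := \pi_({eq_quot (@iso_equiv k n)})%qT M.

Lemma cls_eq M N : cls M = cls N <-> iso M N.
Proof.
split=> [/eqmodP|h]; first by move/asboolP.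
by apply/eqmodP/asboolP.
Qed.

Lemma cls_module X : cls X = X.
Proof. exact: reprK. Qed.

Lemma module_cls M : iso (cls M) M.
Proof. by apply/cls_eq; rewrite cls_module. Qed.

Lemma P_cls M N : has_cover N M -> P_ (cls M) = cls N.
Proof.
move=> c; have c' := has_cover_iso (iso_refl _) (iso_sym (module_cls M)) c.
apply: xget_unique; first exact: has_cover_iso (iso_sym (module_cls N)) (iso_refl _) c'.
by move=> Y cY; rewrite -(cls_module Y); apply/cls_eq; apply: has_cover_uniq cY c'.
Qed.

Lemma I_cls M N : has_envelope N M -> I_ (cls M) = cls N.
Proof.
move=> c; have c' := has_envelope_iso (iso_refl _) (iso_sym (module_cls M)) c.
apply: xget_unique; first exact: has_envelope_iso (iso_sym (module_cls N)) (iso_refl _) c'.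
by move=> Y cY; rewrite -(cls_module Y); apply/cls_eq; apply: has_envelope_uniq cY c'.
Qed.

Definition simp m := cls (nak false m).
Definition proj m := cls (nak true m).

Lemma P_simp m : (0 < m)%N -> P_ (simp m) = proj m.
Proof. by move=> m0; apply: P_cls; exists (pi_ m); apply: proj_cover_nak. Qed.

Lemma I_simp m : (m < n)%N -> I_ (simp m.+1) = proj m.
Proof. by move=> m0; apply: I_cls; exists (iota_ m); apply: inj_envelope_nak. Qed.

Lemma I_simp0 : I_ (simp 0) = simp 0.
Proof. by apply: I_cls; exists (hom_id _); apply/zero_envelope/nak0_zero. Qed.

(** Counting dimensions in the cover gives those of a syzygy, and they determine it by
    [thin_iso_simple]. For t + m > n both sides are the zero class. *)
Lemma Omega_simp t m : (0 < m)%N -> Omega t (simp m) = simp (t + m).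
Proof.
move=> m0; elim: t => [//|t IH]; rewrite [LHS]/= -/(Omega t (simp m)) IH.
apply: xget_unique.
  have tm : (0 < t + m)%N by lia.
  exact: syzygy_iso (iso_sym (module_cls _)) (iso_sym (module_cls _)) (@syzygy_nak k n _ tm).
move=> Y sY; rewrite -(cls_module Y); apply/cls_eq/thin_iso_simple => i.
have sY' := syzygy_iso (iso_refl _) (module_cls _) sY.
have c : has_cover (nak true (t + m)) (nak false (t + m)).
  by exists (pi_ _); apply: proj_cover_nak; lia.
by have := syzygy_dim i sY' c; rewrite !nak_dim /=; lia.
Qed.

Lemma Sigma_simp t m : (m <= n)%N -> Sigma t (simp m) = simp (m - t).
Proof.
move=> mn; elim: t => [|t IH]; first by rewrite subn0.
rewrite [LHS]/= -/(Sigma t (simp m)) IH.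
have [I [c s]] : exists I, has_envelope I (nak false (m - t)) /\
    is_cosyzygy (nak false (m - t.+1)) (nak false (m - t)).
  have [mt|mt] := posnP (m - t).
    have -> : (m - t.+1 = 0)%N by lia.
    rewrite mt; exists (nak false 0); split; last exact/zero_cosyzygy/nak0_zero.
    by exists (hom_id _); apply/zero_envelope/nak0_zero.
  have -> : (m - t = (m - t.+1).+1)%N by lia.
  exists (nak true (m - t.+1)); split; last by apply: cosyzygy_nak; lia.
  by exists (iota_ _); apply: inj_envelope_nak; lia.
apply: xget_unique; first by apply: cosyzygy_iso s; apply: iso_sym; apply: module_cls.
move=> Y sY; rewrite -(cls_module Y); apply/cls_eq/thin_iso_simple => i.
have sY' := cosyzygy_iso (iso_refl _) (module_cls _) sY.
by have := cosyzygy_dim i sY' c; have := cosyzygy_dim i s c; lia.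
Qed.

Definition valid e m := (0 < m)%N && (m + e <= n)%N.

Lemma cls_nak_inj e m e' m' : valid e m -> valid e' m' ->
  cls (nak e m) = cls (nak e' m') -> e = e' /\ m = m'.
Proof.
by move=> /andP[m0 mn] /andP[m'0 m'n] /cls_eq; apply: nak_iso_inj.
Qed.

Lemma exceptional_cls X : exceptional X <-> exists e m, valid e m /\ X = cls (nak e m).
Proof.
split=> [/exceptionalP[bX _]|[e [m [/andP[m0 mn] ->]]]]; last first.
  exact: exceptional_iso (iso_sym (module_cls _)) (nak_exceptional m0 mn).
have [e [m [m0 mn I]]] := brick_nak bX.
by exists e, m; split; [apply/andP|rewrite -(cls_module X); apply/cls_eq].
Qed.

Lemma pair_cls e m e' m' : valid e m -> valid e' m' ->
  exceptional_pair (cls (nak e m)) (cls (nak e' m')) <-> okpair e m e' m'.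
Proof.
move=> /andP[m0 mn] /andP[m'0 m'n]; apply: iff_trans (@nak_pair k n _ _ _ _ m0 mn m'0 m'n).
by split; [exact: exceptional_pair_iso (module_cls _) (module_cls _)
          |exact: exceptional_pair_iso (iso_sym (module_cls _)) (iso_sym (module_cls _))].
Qed.

Lemma simple_cls e m : valid e m -> simple (cls (nak e m)) <-> ~~ e.
Proof.
move=> /andP[m0 mn]; have I := module_cls (nak e m); split.
  by move/(simple_iso I); case: e mn I => // mn I /nak_not_simple; case; lia.
case: e mn I => // mn I _; apply: simple_iso (iso_sym I) _; apply: nak_simple; lia.
Qed.

(* The chain from [a] to [b, b+1] consists, apart from [a], of the [c, c+1]
   with c between a and b: from a up to b for a projective chain, from a - 1
   down to b for an injective one. *)
Definition chain_range a b c :=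
  if (a <= b)%N then (a <= c <= b)%N else (b <= c < a)%N.

Lemma contains_chainE (E : n.-tuple (isoclass k n)) a b :
  (0 < a <= n)%N -> (0 < b < n)%N -> simp a \in E ->
  contains_chain E (simp a) (proj b) <-> forall c, chain_range a b c -> proj c \in E.
Proof.
move=> an bn aE; have vb : valid true b by rewrite /valid; lia.
split.
  move=> [t [[_ bt sub] c|[_ bt sub] c]].
    move: bt; rewrite Omega_simp ?P_simp; try lia.
    move=> /cls_eq I.
    have D (i : nat) : (i < n)%N ->
        ((i.+1 == b) + (i.+1 == b.+1) = (i.+1 == t + a) + (i.+1 == (t + a).+1))%N.
      by move=> h; have := iso_dim (Ordinal h) I; rewrite !nak_dim.
    have bta : b = (t + a)%N.
      by move: (D b.-1) (D b); rewrite prednK; lia.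
    rewrite /chain_range ifT => [cab|]; last by lia.
    apply: sub; rewrite /proj_chain mem_rcons inE; apply/orP; right.
    apply/mapP; exists (c - a)%N; first by rewrite mem_rev mem_iota; lia.
    by rewrite Omega_simp ?P_simp ?subnK; try lia.
  move: bt; rewrite Sigma_simp; last by lia.
  (* For t at least a the cosyzygy is zero, and so is its envelope, which therefore is not
     [b, b+1]. *)
  have [ta|ta] := leqP a t.
    rewrite (eqP ta) I_simp0 => /cls_eq I; exfalso.
    have bn' : (b.-1 < n)%N by lia.
    by have := iso_dim (Ordinal bn') I; rewrite !nak_dim /=; lia.
  have -> : (a - t = (a - t.+1).+1)%N by lia.
  rewrite I_simp; last by lia.
  move=> /cls_eq I.
  have D (i : nat) : (i < n)%N ->
      ((i.+1 == b) + (i.+1 == b.+1) = (i.+1 == a - t.+1) + (i.+1 == (a - t.+1).+1))%N.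
    by move=> h; have := iso_dim (Ordinal h) I; rewrite !nak_dim.
  have bta : b = (a - t.+1)%N.
    by move: (D b.-1) (D b); rewrite prednK; lia.
  rewrite /chain_range ifF => [cab|]; last by lia.
  apply: sub; rewrite inE; apply/orP; right.
  (* [c, c+1] is the envelope of [c+1], which is the cosyzygy of [a] of order a - c - 1. *)
  apply/mapP; exists (a - c).-1; first by rewrite mem_iota; lia.
  have ac : (a - (a - c).-1)%N = c.+1 by clear D I; lia.
  have cn : (c < n)%N by clear D I; lia.
  by rewrite Sigma_simp ?ac ?I_simp //; case/andP: an.
move=> sub; move: sub; rewrite /chain_range; case: (leqP a b) => ab sub.
  exists (b - a)%N; left; split.
  - apply: (lt_pdim_iso (iso_sym (module_cls _))); apply: lt_pdim_simple; lia.
  - by rewrite Omega_simp ?P_simp ?subnK; try lia.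
  move=> X; rewrite /proj_chain mem_rcons inE => /orP[/eqP->//|/mapP[s]].
  rewrite mem_rev mem_iota => sab ->.
  by rewrite Omega_simp ?P_simp; try lia; apply: sub; lia.
exists (a - b).-1; right; split.
- apply: (lt_indim_iso (iso_sym (module_cls _))); apply: lt_indim_simple; lia.
- have ac : (a - (a - b).-1)%N = b.+1 by lia.
  have cn : (b < n)%N by lia.
  by rewrite Sigma_simp ?ac ?I_simp //; case/andP: an.
move=> X; rewrite inE => /orP[/eqP->//|/mapP[s]].
rewrite mem_iota => sab ->.
have as1 : (a - s)%N = (a - s.+1).+1 by lia.
have sn : (a - s.+1 < n)%N by lia.
by rewrite Sigma_simp ?as1 ?I_simp //; [apply: sub; lia|case/andP: an].
Qed.

End Classes.

Local Close Scope ring_scope.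

(** * Combinatorics of exceptional sequences of labels *)

Section Labels.
Context {n : nat}.
Local Notation valid := (@valid n).
Implicit Types f : {ffun 'I_n -> 'I_n}.
Implicit Types i j : 'I_n.

Definition good (lam : 'I_n -> bool * nat) :=
  (forall i, valid (lam i).1 (lam i).2) /\
  forall i j : 'I_n, i < j -> okpair (lam i).1 (lam i).2 (lam j).1 (lam j).2.

(** * Order relations and chains in an exceptional sequence *)

Section Good.
Variable lam : 'I_n -> bool * nat.
Hypothesis glam : good lam.

Definition present c := [exists i, lam i == (true, c)].

Lemma presentP c : reflect (exists i, lam i = (true, c)) (present c).
Proof. by apply: (iffP existsP) => -[i /eqP]; exists i => //; apply/eqP. Qed.

Lemma good_not_after i j : ~~ okpair (lam j).1 (lam j).2 (lam i).1 (lam i).2 -> i <= j.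
Proof. by move=> nok; rewrite leqNgt; apply/negP => /glam.2; apply/negP. Qed.

Lemma good_inj : injective lam.
Proof.
move=> i j ij; apply: val_inj; apply/eqP; rewrite eqn_leq.
by rewrite !good_not_after // ?ij /okpair /homb eqxx implybb.
Qed.

Lemma simple_order i j a a' : lam i = (false, a) -> lam j = (false, a') -> a < a' -> i < j.
Proof.
move=> li lj aa; rewrite ltn_neqAle good_not_after ?andbT; last first.
  by rewrite li lj /okpair /=; apply/negP => /andP[]; lia.
by apply: contraTneq aa => /val_inj ij; move: li; rewrite ij lj => -[->]; rewrite ltnn.
Qed.

Lemma proj_order i j c : lam i = (true, c) -> lam j = (true, c.+1) -> j < i.
Proof.
move=> li lj; rewrite ltn_neqAle good_not_after ?andbT; last first.
  by rewrite li lj /okpair /homb /= eqxx orbT.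
by apply/eqP => /val_inj ij; move: lj; rewrite ij li => -[]; lia.
Qed.

Lemma proj_before_top i j c : lam i = (true, c) -> lam j = (false, c) -> i < j.
Proof.
move=> li lj; rewrite ltn_neqAle good_not_after ?andbT; last first.
  by rewrite li lj /okpair /homb /= eqxx.
by apply/eqP => /val_inj ij; move: li; rewrite ij lj.
Qed.

Lemma socle_before_proj i j c : lam i = (false, c.+1) -> lam j = (true, c) -> i < j.
Proof.
move=> li lj; rewrite ltn_neqAle good_not_after ?andbT; last first.
  by rewrite li lj /okpair /homb /= eqxx orbT.
by apply/eqP => /val_inj ij; move: li; rewrite ij lj.
Qed.

Lemma proj_run p q c d : lam p = (true, c) -> lam q = (true, c + d) ->
  (forall x, c <= x < c + d -> present x) -> q <= p.
Proof.
move=> lp; elim: d q => [|d IH] q lq pr.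
  by rewrite addn0 -lp in lq; rewrite (good_inj lq).
have /presentP[q' lq'] : present (c + d) by apply: pr; lia.
rewrite addnS in lq; apply: ltnW; apply: leq_trans (proj_order lq' lq) _.
by apply: IH lq' _ => x xd; apply: pr; lia.
Qed.

(** The cycle is: [a] before [a'], [a'] before [a'-1, a'], the latter not after [a, a+1] by
    [proj_run], and [a, a+1] before [a]. *)
Lemma no_run i j a a' : lam i = (false, a) -> lam j = (false, a') -> a < a' ->
  ~ forall c, a <= c < a' -> present c.
Proof.
move=> li lj aa pr; have ij := simple_order li lj aa.
have /presentP[p lp] : present a by apply: pr; lia.
have /presentP[q lq] : present a'.-1 by apply: pr; lia.
have jq : j < q by apply: (@socle_before_proj _ _ a'.-1) lq; rewrite prednK //; lia.
have qp : q <= p.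
  apply: (@proj_run _ _ a (a'.-1 - a)) lp _ _ => [|x xa]; first by rewrite subnKC //; lia.
  by apply: pr; lia.
by have := proj_before_top lp li; lia.
Qed.

Definition chain j i :=
  (lam j).1 = false /\ forall c, chain_range (lam j).2 (lam i).2 c -> present c.

(* If [b, b+1] has no chain, sending each [c, c+1] to c and each [a] to the
   missing c nearest to a on the side of b is injective from n positions to
   n - 1 values. *)
Lemma chain_exists i : (lam i).1 -> exists j, chain j i.
Proof.
case li : (lam i) => [[] b] //= _; apply: contrapT => nch.
have vi := glam.1 i; rewrite li /= in vi.
have pb : present b by apply/presentP; exists i.
pose Q a c := ~~ present c /\
  if a <= b then a <= c <= b /\ (forall x, a <= x < c -> present x)
  else b <= c < a /\ (forall x, c < x < a -> present x).
have gap j a : lam j = (false, a) -> exists c, Q a c.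
  move=> lj; have [c0 rc0 nc0] : exists2 c, chain_range a b c & ~~ present c.
    apply: contrapT => h; apply: nch; exists j; rewrite /chain lj li; split=> // c rc.
    by apply: contrapT => nc; apply: h; exists c => //; apply/negP.
  rewrite /Q; move: rc0; rewrite /chain_range; case: ifP => ab rc0.
    have ex : exists c, (a <= c) && ~~ present c by exists c0; rewrite nc0; lia.
    case: (ex_minnP ex) => c /andP[ac nc] cmin; exists c; split=> //.
    have cc0 : c <= c0 by apply: cmin; rewrite nc0; lia.
    split=> [|x xc]; first by lia.
    apply: contrapT => /negP nx; have := cmin x; rewrite nx; lia.
  have ex : exists c, (c < a) && ~~ present c by exists c0; rewrite nc0; lia.
  have ub c : (c < a) && ~~ present c -> c <= a by lia.
  case: (ex_maxnP ex ub) => c /andP[ac nc] cmax; exists c; split=> //.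
  have cc0 : c0 <= c by apply: cmax; rewrite nc0; lia.
  split=> [|x xc]; first by lia.
  apply: contrapT => /negP nx; have := cmax x; rewrite nx; lia.
(* Values are stored shifted by one, the indices c of nonsimples being 1, ..., n - 1. *)
have /choice[h hP] : forall j, exists c : 'I_n.-1,
    if (lam j).1 then (lam j).2 = c.+1 else Q (lam j).2 c.+1.
  move=> j; have := glam.1 j; case lj : (lam j) => [[] m] /= vj.
    have mn : m.-1 < n.-1 by move: vj; rewrite /valid; lia.
    by exists (Ordinal mn) => /=; rewrite prednK //; move: vj; rewrite /valid; lia.
  have [c Qc] := gap j m lj.
  have cn : 0 < c < n.
    move: Qc vj vi; rewrite /Q /valid => -[_].
    by case: ifP => mb [cb _]; lia.
  have mn : c.-1 < n.-1 by lia.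
  by exists (Ordinal mn) => /=; rewrite prednK //; lia.
suff inj : injective h by have := leq_card h inj; rewrite !card_ord; move: vi; rewrite /valid; lia.
(* Two simples with the same gap c: on the same side of b, the run of the one farther from c covers
   all indices between them, against [no_run]; on opposite sides c would be b, which is present. *)
have key j j' a a' : lam j = (false, a) -> lam j' = (false, a') -> a < a' ->
    h j = h j' -> False.
  move=> lj lj' aa hh; have := hP j; have := hP j'; rewrite lj lj' -hh /= /Q.
  move: (h j).+1 => c; move=> [nc q'] [_ q]; have nb : c <> b by move=> cb; rewrite cb pb in nc.
  move: q q'; case: ifP => ab [ca pa]; case: ifP => a'b [ca' pa']; try lia.
    by apply: (no_run lj lj' aa) => x xa; apply: pa; lia.
  by apply: (no_run lj lj' aa) => x xa; apply: pa'; lia.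
move=> j j' hh; apply: good_inj; have := hP j; have := hP j'.
case lj : (lam j) => [[] m]; case lj' : (lam j') => [[] m'] /=.
- by move=> -> ->; rewrite hh.
- move=> [nm _] mh; case/negP: nm; apply/presentP; exists j; by rewrite lj mh hh.
- move=> mh [nm _]; case/negP: nm; apply/presentP; exists j'; by rewrite lj' mh hh.
move=> _ _; congr pair; have [mm|mm|//] := ltngtP m m'.
  by case: (key j j' m m').
by case: (key j' j m' m).
Qed.

Lemma chain_unique i j j' : chain j i -> chain j' i -> j = j'.
Proof.
wlog aa : j j' / (lam j).2 <= (lam j').2.
  by move=> W c c'; have [?|/ltnW ?] := leqP (lam j).2 (lam j').2; [|symmetry]; apply: W.
move=> [sj cj] [sj' cj']; apply: good_inj.
case lj : (lam j) sj aa cj => [e a] /= e0 aa cj; subst e.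
case lj' : (lam j') sj' aa cj' => [e' a'] /= e0 aa cj'; subst e'.
congr pair; move: aa; rewrite leq_eqVlt => /orP[/eqP//|aa].
(* The two chains meet at i and together cover every index from a to a'. *)
case: (no_run lj lj' aa) => c ca; have [cb|cb] := leqP c (lam i).2.
  by have [ab|ab] := leqP a (lam i).2; [apply: cj|apply: cj']; rewrite /chain_range; case: ifP; lia.
by apply: cj'; rewrite /chain_range; case: ifP; lia.
Qed.

End Good.

(* The order of the positions by slot; the slot of i will be rk f i + 1. *)
Definition precedes (f : {ffun 'I_n -> 'I_n}) (i j : 'I_n) :=
  (f i < f j) || (f i == f j) && (j < i).

Definition rk f i := #|[pred j | precedes f j i]|.

Definition label_of f i : bool * nat :=
  if f i == i then (false, (rk f i).+1)
  else (true, if i < f i then rk f i else (rk f i).+1).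

Lemma precedes_trans f : transitive (precedes f).
Proof.
move=> j i l /orP[h|/andP[/eqP h h']] /orP[g|/andP[/eqP g g']]; apply/orP.
- by left; apply: ltn_trans g.
- by left; rewrite -g.
- by left; rewrite h.
- by right; rewrite h g eqxx; apply: ltn_trans h'.
Qed.

Lemma precedes_irr f i : precedes f i i = false.
Proof. by rewrite /precedes !ltnn andbF. Qed.

Lemma precedes_total f i j : i != j -> precedes f i j || precedes f j i.
Proof.
rewrite /precedes -(inj_eq val_inj) -[f i == f j](inj_eq val_inj) -[f j == f i](inj_eq val_inj) /=.
by case: (ltngtP (f i) (f j)) => //= _; case: ltngtP.
Qed.

Lemma rk_mono f i j : precedes f i j -> rk f i < rk f j.
Proof.
move=> ij; apply: proper_card; apply/properP; split.
  by apply/fintype.subsetP => x; rewrite !inE => xi; apply: precedes_trans ij.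
by exists i; rewrite inE ?ij ?precedes_irr.
Qed.

Lemma rkE f i j : (rk f i < rk f j) = precedes f i j.
Proof.
apply/idP/idP => [|/rk_mono//].
have [->|/(precedes_total f)/orP[//|/rk_mono ji]] := eqVneq i j; first by rewrite ltnn.
by lia.
Qed.

Lemma rk_inj f : injective (rk f).
Proof.
move=> i j ij; apply/eqP/negPn/negP => /(precedes_total f).
by rewrite -!rkE ij ltnn.
Qed.

Lemma rk_lt f i : rk f i < n.
Proof.
rewrite -[X in _ < X](card_ord n); apply: proper_card; apply/properP; split.
  exact: subset_predT.
by exists i; rewrite ?inE ?precedes_irr.
Qed.

Lemma rk_surj f c : c < n -> exists i, rk f i = c.
Proof.
move=> cn; pose g i := Ordinal (rk_lt f i).
have gi : injective g by move=> i j [/rk_inj].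
have [g' _ g'K] := injF_bij gi.
by exists (g' (Ordinal cn)); have := congr1 val (g'K (Ordinal cn)).
Qed.

(** Such an [s] is a bijection onto the numbers below n, so [s i] counts the predecessors of i. *)
Lemma rk_unique f (s : 'I_n -> nat) : (forall i, s i < n) ->
  (forall i j, precedes f i j -> s i < s j) -> s =1 rk f.
Proof.
move=> sn sm.
have sE i j : (s i < s j) = precedes f i j.
  apply/idP/idP => [|/sm//].
  have [->|/(precedes_total f)/orP[//|/sm ji]] := eqVneq i j; first by rewrite ltnn.
  by lia.
pose g i := Ordinal (sn i).
have gi : injective g.
  move=> i j [ij]; apply/eqP/negPn/negP => /(precedes_total f).
  by rewrite -!sE ij ltnn.
move=> i; rewrite /rk -sum1_card.
have -> : \sum_(j in [pred j | precedes f j i]) 1 = \sum_(x < n | x < s i) 1.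
  rewrite [RHS](reindex g); last exact/onW_bij/injF_bij.
  by apply: eq_bigl => j; rewrite inE -sE.
by rewrite -(big_ord_widen n (fun=> 1)) ?sum1_card ?card_ord // ltnW.
Qed.


(** * From an idempotent function to an exceptional sequence *)

Section LabelOf.
Variable f : {ffun 'I_n -> 'I_n}.
Hypothesis ff : forall i, f (f i) = f i.

Lemma rk_fixed_lt i : f i < i -> rk f i < rk f (f i).
Proof. by move=> h; apply: rk_mono; rewrite /precedes ff eqxx h orbT. Qed.

Lemma rk_fixed_gt i : i < f i -> rk f (f i) < rk f i.
Proof. by move=> h; apply: rk_mono; rewrite /precedes ff eqxx h orbT. Qed.

Lemma label_of_good : good (label_of f).
Proof.
split=> [i|i j ij].
  have rin := rk_lt f i; rewrite /label_of /valid; case: eqP => [_|ne]; first by rewrite /= addn0.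
  have rfn := rk_lt f (f i).
  have [/rk_fixed_gt h|/rk_fixed_lt h|/esym/val_inj//] := ltngtP i (f i); rewrite /=; lia.
(* Across fibres, all ranks in the fibre with the smaller value, its fixed point included, lie below
   those of the other; this leaves linear arithmetic. *)
have mono_f x y : f x < f y -> rk f x < rk f y.
  by move=> h; apply: rk_mono; rewrite /precedes h.
have [h|h|/val_inj h] := ltngtP (f i) (f j).
- have r1 := mono_f _ _ h.
  have r2 : rk f (f i) < rk f j by apply: mono_f; rewrite ff.
  have r3 : rk f i < rk f (f j) by apply: mono_f; rewrite ff.
  have r4 : rk f (f i) < rk f (f j) by apply: mono_f; rewrite !ff.
  rewrite /label_of -!val_eqE /=.
  have [/rk_fixed_gt hi|/rk_fixed_lt hi|fi] := ltngtP i (f i);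
  have [/rk_fixed_gt hj|/rk_fixed_lt hj|fj] := ltngtP j (f j);
  rewrite /okpair /homb /=; lia.
- have r1 := mono_f _ _ h.
  have r2 : rk f (f j) < rk f i by apply: mono_f; rewrite ff.
  have r3 : rk f j < rk f (f i) by apply: mono_f; rewrite ff.
  have r4 : rk f (f j) < rk f (f i) by apply: mono_f; rewrite !ff.
  rewrite /label_of -!val_eqE /=.
  have [/rk_fixed_gt hi|/rk_fixed_lt hi|fi] := ltngtP i (f i);
  have [/rk_fixed_gt hj|/rk_fixed_lt hj|fj] := ltngtP j (f j);
  rewrite /okpair /homb /=; lia.
have r1 : rk f j < rk f i by apply: rk_mono; rewrite /precedes h eqxx ij orbT.
rewrite /label_of -!val_eqE /=.
have := @rk_fixed_gt i; have := @rk_fixed_lt i; have := @rk_fixed_gt j; have := @rk_fixed_lt j.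
rewrite h => j1 j2 i1 i2.
have [/i2 hi|/i1 hi|fi] := ltngtP i (f j);
have [/j2 hj|/j1 hj|fj] := ltngtP j (f j);
rewrite /okpair /homb /=; lia.
Qed.

(** Fibres occupy intervals of ranks: a larger value at x would put x above both i and [f i], a
    smaller one below both. *)
Lemma fixed_between i x : f i = f x \/ rk f x <= maxn (rk f i) (rk f (f i)) ->
  f i = f x \/ minn (rk f i) (rk f (f i)) <= rk f x -> f x = f i.
Proof.
move=> [->//|up] [->//|lo].
apply/eqP; rewrite -(inj_eq val_inj) eqn_leq; apply/andP; split; rewrite leqNgt; apply/negP => h.
  have r1 : rk f i < rk f x by apply: rk_mono; rewrite /precedes h.
  have r2 : rk f (f i) < rk f x by apply: rk_mono; rewrite /precedes ff h.
  lia.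
have r1 : rk f x < rk f i by apply: rk_mono; rewrite /precedes h.
have r2 : rk f x < rk f (f i) by apply: rk_mono; rewrite /precedes ff h.
lia.
Qed.

Lemma label_of_chain i : f i != i -> chain (label_of f) (f i) i.
Proof.
move=> ne; have ri := rk_lt f i; have rfi := rk_lt f (f i).
rewrite /chain {1 2}/label_of ff eqxx; split=> // c.
rewrite /label_of (negbTE ne) /= /chain_range => rc.
have [h|h|/esym/val_inj e] := ltngtP i (f i); last by rewrite e eqxx in ne.
  have hr := rk_fixed_gt h; rewrite h ifT in rc; last by lia.
  (* The term [c, c+1] has slot c + 1 on this side, that is rank c. Its position x lies in the fibre
     of i, and its rank places it before [f i]. *)
  have [|x xc] := @rk_surj f c; first by lia.
  have fx : f x = f i by apply: fixed_between; right; lia.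
  have xfi : x < f i.
    rewrite ltnNge leq_eqVlt; apply/negP => /orP[/eqP/val_inj e|e].
      by move: xc; rewrite -e; lia.
    by have := @rk_fixed_lt x; rewrite fx => /(_ e); lia.
  apply/presentP; exists x; rewrite fx xfi -(inj_eq val_inj) /= xc; case: eqP => // e.
  by move: xfi; rewrite e ltnn.
have hr := rk_fixed_lt h; rewrite (ltnNge i) (ltnW h) /= ifF in rc; last by lia.
(* After [f i], the term [c, c+1] has slot c, that is rank c - 1. *)
have [|x xc] := @rk_surj f c.-1; first by lia.
have fx : f x = f i by apply: fixed_between; right; lia.
have xfi : f i < x.
  rewrite ltnNge leq_eqVlt; apply/negP => /orP[/eqP/val_inj e|e]; first by move: xc; rewrite e; lia.
  by have := @rk_fixed_gt x; rewrite fx => /(_ e); lia.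
apply/presentP; exists x; rewrite fx ltnNge (ltnW xfi) -(inj_eq val_inj) /= xc.
by case: eqP => [e|_]; [move: xfi; rewrite e ltnn|rewrite prednK //; lia].
Qed.

End LabelOf.

(** * Recovering the labels from the idempotent function *)

Section Reconstruction.
Variables (lam : 'I_n -> bool * nat) (f : {ffun 'I_n -> 'I_n}).
Hypothesis glam : good lam.
Hypothesis f_simple : forall i, ~~ (lam i).1 -> f i = i.
Hypothesis f_proj : forall i, (lam i).1 -> chain lam (f i) i.

Definition slot i := let a := (lam (f i)).2 in let: (e, b) := lam i in
  if e && (a <= b) then b.+1 else b.

(** Nonsimples on a projective chain stand before their simple, those on an injective chain after
    it; comparing i with [f i] tells the kinds apart. *)
Variant slot_spec i a : Prop :=
  | SlotSimple of f i = i :> nat & lam i = (false, a) & slot i = a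
  | SlotBefore b of i < f i & lam i = (true, b) & slot i = b.+1 & a <= b
  | SlotAfter of f i < i & lam i = (true, slot i) & slot i < a.

Lemma slotP i : exists2 a, lam (f i) = (false, a) &
  slot_spec i a /\ (forall c, a <= c < slot i \/ slot i <= c < a -> present lam c).
Proof.
have [e|e] := boolP (lam i).1; last first.
  have fi := f_simple e; exists (lam i).2; rewrite ?fi.
    by case: (lam i) e => [[] a].
  have li : lam i = (false, (lam i).2) by case: (lam i) e => [[] a].
  have s : slot i = (lam i).2 by rewrite /slot li.
  by split; [apply: SlotSimple; rewrite ?fi|rewrite s => c; lia].
have [la ca] := f_proj e; case lf : (lam (f i)) la ca => [e' a] /= e0 ca; subst e'.
case li : (lam i) e ca => [[] b] //= _ ca; exists a => //.
have [ab|ab] := leqP a b.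
  have s : slot i = b.+1 by rewrite /slot li lf /= ab.
  rewrite s; split=> [|c cab]; last by apply: ca; rewrite /chain_range ab; lia.
  apply: (@SlotBefore _ _ b) => //.
  (* The run from a to b stands in reverse order, so i is not after [a, a+1], which precedes [a]. On
     an injective chain [a-1, a] takes this part, following [a]. *)
  have /presentP[p lp] : present lam a by apply: ca; rewrite /chain_range ab; lia.
  have ip : i <= p.
    apply: (@proj_run _ glam _ _ a (b - a)) lp _ _ => [|x xa]; first by rewrite subnKC.
    by apply: ca; rewrite /chain_range ab; lia.
  by have := proj_before_top glam lp lf; lia.
have s : slot i = b by rewrite /slot li lf /= leqNgt ab.
rewrite s; split=> [|c cab]; last by apply: ca; rewrite /chain_range leqNgt ab /=; lia.
apply: SlotAfter; rewrite ?s //.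
have /presentP[p lp] : present lam a.-1.
  by apply: ca; rewrite /chain_range leqNgt ab /=; lia.
have pi : p <= i.
  apply: (@proj_run _ glam _ _ b (a.-1 - b)) li _ _ => [|x xa]; first by rewrite subnKC //; lia.
  by apply: ca; rewrite /chain_range leqNgt ab /=; lia.
suff : f i < p by lia.
by apply: (@socle_before_proj _ glam _ _ a.-1) lp; rewrite prednK //; lia.
Qed.

(** For distinct simples [a] and [b], slots in the wrong order would make the chains cover all
    indices from a to b. Within one fibre, [proj_run] orders the terms on each side. *)
Lemma slot_mono i j : precedes f i j -> slot i < slot j.
Proof.
have [a la [sa pa]] := slotP i; have [b lb [sb pb]] := slotP j.
rewrite ltnNge => /orP[h|/andP[/eqP h ji]]; apply/negP => le.
  have ab : a < b.
    rewrite ltnNge leq_eqVlt; apply/negP => /orP[/eqP e|e].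
      have fij : f i = f j by apply: (good_inj glam); rewrite la lb e.
      by move: h; rewrite fij ltnn.
    by have := simple_order glam lb la e; lia.
  apply: (no_run glam la lb ab) => c cab.
  by have [cs|cs] := ltnP c (slot i); [apply: pa|apply: pb]; lia.
have e : a = b by move: lb; rewrite -h la => -[].
subst b; case: sa => [fi li si|x fi li si ax|fi li si];
  case: sb => [fj lj sj|y fj lj sj ay|fj lj sj];
  have := congr1 val h => /= hn; try lia.
- suff : i <= j by lia.
  apply: (@proj_run _ glam _ _ y (x - y)) lj _ _ => [|z zx]; first by rewrite subnKC //; lia.
  by apply: pa; lia.
- suff : i <= j by lia.
  apply: (@proj_run _ glam _ _ (slot j) (slot i - slot j)) lj _ _ => [|z zx].
    by rewrite subnKC //; lia.
  by apply: pb; lia.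
Qed.

(** By [rk_unique] the slot is the rank plus one, hence depends on [f] alone; [slot_spec] then reads
    off the label. *)
Lemma label_ofE : lam =1 label_of f.
Proof.
have s0 i : 0 < slot i <= n.
  have [a la [sa _]] := slotP i; have := glam.1 i; rewrite /valid.
  by case: sa => [_ ->|b _ -> ->|_ ->] /=; lia.
have sr i : slot i = (rk f i).+1.
  rewrite -(@rk_unique f (fun i => (slot i).-1)); first by have := s0 i; lia.
    by move=> j; have := s0 j; lia.
  by move=> x y /slot_mono; have := s0 x; lia.
move=> i; have [a la [sa _]] := slotP i; rewrite /label_of -sr.
case: sa => [fi li si|b fi li si ab|fi li si].
- by rewrite (val_inj fi) eqxx li si.
- by rewrite fi -(inj_eq val_inj) /= eqn_leq leqNgt fi /= li; congr pair; have := sr i; lia.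
by rewrite ltnNge (ltnW fi) -(inj_eq val_inj) /= eqn_leq [i <= _]leqNgt fi andbF li.
Qed.

End Reconstruction.

End Labels.

(** * The bijection *)

Section Sequences.
Context {k : fieldType} {n : nat}.
Implicit Types E : n.-tuple (isoclass k n).

Definition labelled E (lam : 'I_n -> bool * nat) :=
  forall i, tnth E i = cls (nak (lam i).1 (lam i).2).

Lemma complete_labelled E : complete_exceptional k n E ->
  exists2 lam, good lam & labelled E lam.
Proof.
move=> [ex pairs].
have /choice[lam lamP] : forall i, exists l : bool * nat,
    @valid n l.1 l.2 /\ tnth E i = cls (nak l.1 l.2).
  by move=> i; have /exceptional_cls[e [m [v ->]]] := ex i; exists (e, m).
exists lam => [|i]; last by case: (lamP i).
split=> [i|i j ij]; first by case: (lamP i).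
have [vi Ei] := lamP i; have [vj Ej] := lamP j.
by apply/(pair_cls (k := k) vi vj); rewrite -Ei -Ej; apply: pairs.
Qed.

Lemma labelled_complete E lam : good lam -> labelled E lam -> complete_exceptional k n E.
Proof.
move=> [v ok] L; split=> [i|i j ij]; rewrite !L.
  by apply/exceptional_cls; exists (lam i).1, (lam i).2.
by apply/pair_cls => //; apply: ok.
Qed.

Section Labelled.
Variables (E : n.-tuple (isoclass k n)) (lam : 'I_n -> bool * nat).
Hypotheses (glam : good lam) (L : labelled E lam).

Lemma simple_label i : simple (tnth E i) <-> ~~ (lam i).1.
Proof. by rewrite L; apply: simple_cls; apply: glam.1. Qed.

Lemma presentE c : (0 < c < n)%N -> (proj c \in E) = present lam c.
Proof.
move=> cn; have vc : @valid n true c by rewrite /valid; lia.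
apply/idP/presentP => [/tnthP[i]|[i li]]; last by apply/tnthP; exists i; rewrite L li.
rewrite L => /(cls_nak_inj vc (glam.1 i))[e m]; exists i.
by case: (lam i) e m => e m /= -> ->.
Qed.

Lemma chainE i j : (lam i).1 ->
  chain lam j i <-> simple (tnth E j) /\ contains_chain E (tnth E j) (tnth E i).
Proof.
move=> e; have vi := glam.1 i; have vj := glam.1 j; rewrite simple_label !L.
case li : (lam i) e vi => [[] b] //= _; rewrite /valid => vi.
rewrite /chain li; case lj : (lam j) vj => [[] a] /=; rewrite /valid => vj.
  by split=> -[].
have an : (0 < a <= n)%N by lia.
have bn : (0 < b < n)%N by lia.
have aE : simp a \in E by apply/tnthP; exists j; rewrite L lj.
have cE := contains_chainE an bn aE.
have cn c : chain_range a b c -> (0 < c < n)%N by rewrite /chain_range; case: ifP; lia.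
split=> [[_ h]|[_ /cE h]]; split=> //.
  by apply/cE => c rc; rewrite presentE ?h ?cn.
by move=> c rc; rewrite -presentE ?h ?cn.
Qed.

Lemma Phi_simple i : ~~ (lam i).1 -> Phi k n E i = i.
Proof. by move=> /simple_label s; rewrite ffunE asboolT. Qed.

Lemma Phi_proj i : (lam i).1 -> chain lam (Phi k n E i) i.
Proof.
move=> e; rewrite ffunE asboolF; last by move/simple_label; rewrite e.
have [j /(chainE _ e) cj] := chain_exists glam e.
(* By [chain_exists] this set is nonempty, so [xget] does not return its default. *)
pose C := [set j' | simple (tnth E j') /\ contains_chain E (tnth E j') (tnth E i)].
by apply/(chainE _ e); apply: (xgetPex i (P := C)); exists j.
Qed.

End Labelled.

(** A value is either the position itself or that of a simple term, which is fixed. *)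
Lemma Phi_idempotent E : idempotent_fun (Phi k n E).
Proof.
move=> i /=; have [fi|s] : Phi k n E i = i \/ simple (tnth E (Phi k n E i)).
- rewrite !ffunE; case: asboolP => [s|ns]; first by left.
  by case: xgetP => [j _ [s _]|_]; [right|left].
- by rewrite !fi.
- by rewrite [LHS]ffunE asboolT.
Qed.

Lemma Phi_inj : set_inj (complete_exceptional k n) (Phi k n).
Proof.
move=> E E' /set_mem/complete_labelled[lam g L] /set_mem/complete_labelled[lam' g' L'] e.
apply: eq_from_tnth => i; rewrite L L'.
rewrite (label_ofE g (@Phi_simple _ _ g L) (@Phi_proj _ _ g L)).
by rewrite (label_ofE g' (@Phi_simple _ _ g' L') (@Phi_proj _ _ g' L')) e.
Qed.

(** The sequence is read off from [label_of f]; where [f] moves i, [chain_unique] identifies the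
    simple found by [Phi] with the one at [f i]. *)
Lemma Phi_surj (f : {ffun 'I_n -> 'I_n}) : idempotent_fun f ->
  exists2 E, complete_exceptional k n E & Phi k n E = f.
Proof.
move=> idem; have ff i : f (f i) = f i := idem i.
pose lam := label_of f; have g : good lam := label_of_good ff.
pose E : n.-tuple (isoclass k n) := [tuple cls (nak (lam i).1 (lam i).2) | i < n].
have L : labelled E lam by move=> i; rewrite tnth_mktuple.
exists E; first exact: labelled_complete g L.
apply/ffunP => i; have [fi|fi] := eqVneq (f i) i.
  by rewrite fi (Phi_simple g L) // /lam /label_of fi eqxx.
apply: (chain_unique g) (label_of_chain ff fi).
by apply: Phi_proj => //; rewrite /lam /label_of (negbTE fi).
Qed.

End Sequences.

Theorem theorem3p7 (k : closedFieldType) (n : nat) (hn : (1 <= n)%N) :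
  set_bij (complete_exceptional k n)
          [set f : {ffun 'I_n -> 'I_n} | idempotent_fun f]
          (Phi k n).
Proof.
split=> [E _|E E'|f idem]; first exact: Phi_idempotent.
  exact: Phi_inj.
by have [E cE <-] := @Phi_surj k n f idem; exists E.
Qed.
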